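(* Let $\mathcal H$ be a Hopf algebra with invertible antipode which models a locally compact quantum group, with dual Hopf algebra $\hat{\mathcal H}=\mathcal H^{*}$, left Haar weight $\varphi$, right Haar weight $\psi=\varphi\circ S^{-1}$, modular element $\delta\in\mathcal H$ and dual modular element $\sigma\in\hat{\mathcal H}$, subject to the standing assumptions listed in the context. Put $\widetilde{\mathcal H}=\hat{\mathcal H}^{\rm op}\otimes\hat{\mathcal H}$. (i) The pair $(\widetilde\delta,\widetilde\sigma)$ with $$\widetilde\delta=\delta^{1/2}\otimes\delta^{-1/2},\qquad \widetilde\sigma=\sigma^{1/2}\otimes\sigma^{1/2},$$ where $\widetilde\delta$ is regarded as the character $\omega_1\otimes\omega_2\mapsto \omega_1(\delta^{1/2})\,\omega_2(\delta^{-1/2})$ of $\widetilde{\mathcal H}$ and $\widetilde\sigma$ is a group-like element of $\widetilde{\mathcal H}$, is a modular pair in involution for the Hopf algebra $\widetilde{\mathcal H}$. (ii) The Haar midweight $\tau:\mathcal H\to\mathbb C$, $\tau(x)=\varphi(\delta^{-1/4}\,x\,\delta^{-1/4})$, is a $\widetilde\delta$-invariant $\widetilde\sigma$-trace for the canonical Hopf action of $\widetilde{\mathcal H}$ on $\mathcal H$ given by $(\omega_1\otimes\omega_2)(x)=\omega_1\cdot x\cdot\omega_2$.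
   Context: **Modular pairs.** Let $\mathcal K$ be a Hopf algebra over $\mathbb C$ with coproduct $\Delta(h)=\sum h_{(1)}\otimes h_{(2)}$, counit $\varepsilon$ and antipode $S$. A *modular pair* $(\delta,\sigma)$ for $\mathcal K$ consists of a character $\delta:\mathcal K\to\mathbb C$ (a unital algebra homomorphism) and a group-like element $\sigma\in\mathcal K$ ($\Delta\sigma=\sigma\otimes\sigma$, $\varepsilon(\sigma)=1$) with $\delta(\sigma)=1$. The $\delta$-twisted antipode is $S_\delta(h)=\sum\delta(h_{(1)})\,S(h_{(2)})$. The modular pair is *in involution* if $(\sigma^{-1}\circ S_\delta)^2=I$, where $\sigma^{-1}\circ S_\delta$ is the map $h\mapsto\sigma^{-1}S_\delta(h)$. **Hopf actions and traces.** A Hopf action of $\mathcal K$ on an algebra $\mathcal A$ is a linear map $\mathcal K\otimes\mathcal A\to\mathcal A$, $h\otimes a\mapsto h(a)$, with $h_1(h_2(a))=(h_1h_2)(a)$ and $h(ab)=\sum h_{(1)}(a)\,h_{(2)}(b)$. Given a modular pair $(\delta,\sigma)$ for $\mathcal K$, a linear form $\tau:\mathcal A\to\mathbb C$ is a *$\sigma$-trace* if $\tau(ab)=\tau(b\,\sigma(a))$ for all $a,b\in\mathcal A$; it is *$\delta$-invariant* if $\tau(h(a)\,b)=\tau(a\,S_\delta(h)(b))$ for all $a,b\in\mathcal A$, $h\in\mathcal K$. **Standing assumptions on $\mathcal H$** (all taken at a formal, algebraic level: weights are treated as linear functionals on $\mathcal H$, and the complex powers and analytic continuations used below are assumed to exist).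 $\mathcal H$ is a Hopf algebra over $\mathbb C$ with invertible antipode $S$. * *Dual.* $\hat{\mathcal H}=\mathcal H^*$ is treated as a Hopf algebra with operations dual to those of $\mathcal H$: product $(\omega_1\ast\omega_2)(x)=\sum\omega_1(x_{(1)})\,\omega_2(x_{(2)})$, coproduct dual to the product of $\mathcal H$ (i.e. $\sum\omega_{(1)}(x)\,\omega_{(2)}(y)=\omega(xy)$), unit $\varepsilon$, counit $\omega\mapsto\omega(1)$, antipode $S(\omega)=\omega\circ S$. $\hat{\mathcal H}^{\rm op}$ is the Hopf algebra with opposite product, the same coproduct, and antipode $S^{-1}$. A group-like element of $\mathcal H$ defines a character of $\hat{\mathcal H}$ (and of $\hat{\mathcal H}^{\rm op}$) by evaluation. * *Left Haar weight.* There is a nonzero left invariant weight $\varphi$ on $\mathcal H$, unique up to scalar: $$(I\otimes\varphi)\big((I\otimes x)\Delta(y)\big)=S\big((I\otimes\varphi)(\Delta(x)(I\otimes y))\big),\qquad x,y\in\mathcal H.$$ It satisfies a KMS condition: there is a modular group of automorphisms $\sigma_t$ of $\mathcal H$, extended to complex values of the parameter, with $\varphi\circ\sigma_t=\varphi$ and $\varphi(xy)=\varphi(\sigma_i(y)\,x)$ for all $x,y\in\mathcal H$ (here $i=\sqrt{-1}$). * *Right Haar weight.* $\psi=\varphi\circ S^{-1}$, which satisfies $(\psi\otimes I)(\Delta(x)(y\otimes1))=S\big((\psi\otimes I)((x\otimes1)\Delta(y))\big)$. * *Modular element.* There is a group-like element $\delta\in\mathcal H$ with $(I\otimes\psi)\Delta(x)=\psi(x)\,\delta$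 for all $x\in\mathcal H$. It has complex powers $\delta^z\in\mathcal H$, $z\in\mathbb C$, which are group-like and satisfy $\delta^z\delta^w=\delta^{z+w}$, $\delta^1=\delta$; moreover $\varphi(x)=\psi(\delta^{1/2}x\,\delta^{1/2})$ for all $x\in\mathcal H$. * *Left and right actions.* For $\omega\in\hat{\mathcal H}$, $x\in\mathcal H$, $$\omega\cdot x=\sum\omega(x_{(1)})\,x_{(2)},\qquad x\cdot\omega=\sum x_{(1)}\,\omega(x_{(2)}).$$ These give the canonical Hopf action of $\widetilde{\mathcal H}=\hat{\mathcal H}^{\rm op}\otimes\hat{\mathcal H}$ on $\mathcal H$, $(\omega_1\otimes\omega_2)(x)=\omega_1\cdot x\cdot\omega_2$. * *Dual modular element.* There is a group-like element $\sigma\in\hat{\mathcal H}$, with group-like complex powers $\sigma^z\in\hat{\mathcal H}$ ($\sigma^z\sigma^w=\sigma^{z+w}$, $\sigma^1=\sigma$), such that the modular groups $\sigma_t$ of $\varphi$ and $\sigma'_t$ of $\psi$ are $$\sigma_t(x)=\delta^{it/2}\,(\sigma^{it/2}\cdot x\cdot\sigma^{it/2})\,\delta^{-it/2},\qquad \sigma'_t(x)=\delta^{-it/2}\,(\sigma^{it/2}\cdot x\cdot\sigma^{it/2})\,\delta^{it/2},\qquad x\in\mathcal H,$$ these formulas being valid also for complex values of $t$ (in particular $t=\pm i$). *)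

(* Defs.v *)
From HB Require Import structures.
From mathcomp Require Import all_boot all_order all_algebra.
From mathcomp Require Import generic_quotient.
From mathcomp Require Import boolp classical_sets reals complex.

Set Implicit Arguments.
Unset Strict Implicit.
Unset Printing Implicit Defensive.

Import GRing.Theory.
Local Open Scope ring_scope.
Local Open Scope quotient_scope.


Section Separation.
Local Open Scope classical_set_scope.
Variables (K : fieldType) (V : lmodType K).

Let submod (M : set V) :=
  [/\ M 0, (forall u v, M u -> M v -> M (u + v)) &
      forall k u, M u -> M (k *: u)].

Lemma separating_functional (v : V) :
  v != 0 -> exists2 f : V -> K^o, linear f & f v = 1.
Proof.
move=> v0.
have submodB M u w : submod M -> M u -> M w -> M (u - w).
  by case=> _ MD MZ Mu Mw; apply: MD => //; rewrite -scaleN1r; apply: MZ.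
have [|M [[sM Mv] maxM]] :=
    @Zorn_bigcup V [set M | ((exists u, M u) -> submod M) /\ ~ M v].
  move=> F FP totF; split; last by move=> [M FM]; apply: (FP M FM).2.
  move=> [w [M0 FM0 M0w]]; split.
  - by exists M0 => //; have [] := (FP _ FM0).1 (ex_intro _ w M0w).
  - move=> u1 u2 [M1 FM1 Mu1] [M2 FM2 Mu2].
    have [M12|M21] := totF _ _ FM1 FM2.
    + exists M2 => //; have [_ MD _] := (FP _ FM2).1 (ex_intro _ _ Mu2).
      by apply: MD => //; apply: M12.
    + exists M1 => //; have [_ MD _] := (FP _ FM1).1 (ex_intro _ _ Mu1).
      by apply: MD => //; apply: M21.
  - move=> k u [M1 FM1 Mu]; exists M1 => //.
    by have [_ _ MZ] := (FP _ FM1).1 (ex_intro _ _ Mu); apply: MZ.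
have ltP B : M `<` B -> ((exists u, B u) -> submod B) -> ~ B v -> False.
  by move=> MB sB Bv; apply: (maxM B MB).
have {}sM : submod M.
  apply: sM; apply: contrapT => Mn.
  apply: (ltP [set (0 : V)]).
  - split; last by move=> /(_ 0 erefl) M0; apply: Mn; exists 0.
    by move=> u Mu; case: Mn; exists u.
  - move=> _; split=> //.
      by move=> u w -> ->; rewrite /set1 /= addr0.
    by move=> k u ->; rewrite /set1 /= scaler0.
  - by move/eqP; apply/negP.
have [M0 MD MZ] := sM.
have dec w : exists k, M (w - k *: v).
  apply: contrapT => nw.
  have Mw : ~ M w by move=> Mw; apply: nw; exists 0; rewrite scale0r subr0.
  apply: (ltP [set u | exists k, M (u - k *: w)]).
  - split; first by move=> u Mu; exists 0; rewrite scale0r subr0.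
    by move=> /(_ w) sub; apply: Mw; apply: sub; exists 1; rewrite scale1r subrr.
  - move=> _; split.
    + by exists 0; rewrite scale0r subr0.
    + move=> u1 u2 [k1 H1] [k2 H2]; exists (k1 + k2).
      by rewrite scalerDl opprD addrACA; apply: MD.
    + move=> k u [l Hl]; exists (k * l).
      by rewrite -scalerA -scalerBr; apply: MZ.
  move=> [k Mk]; apply: nw.
  have k0 : k != 0.
    by apply/eqP => k0; apply: Mv; move: Mk; rewrite k0 scale0r subr0.
  exists k^-1.
  suff -> : w - k^-1 *: v = (- k^-1) *: (v - k *: w) by apply: MZ.
  by rewrite scalerBr scalerA mulNr mulVf // !scaleNr scale1r opprK addrC.
have uni w k l : M (w - k *: v) -> M (w - l *: v) -> k = l.
  move=> Mk Ml; apply/eqP; rewrite -subr_eq0; apply/negP => /negP kl0.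
  apply: Mv; have := submodB _ _ _ sM Ml Mk.
  rewrite opprB addrC addrA subrK -scalerBl => /(MZ (k - l)^-1).
  by rewrite scalerA mulVf // scale1r.
pose f w := projT1 (cid (dec w)).
have fP w : M (w - f w *: v) := projT2 (cid (dec w)).
exists f; last by apply: (uni v) => //; rewrite scale1r subrr.
move=> k u w; apply: (uni (k *: u + w)); first exact: fP.
rewrite scalerDl opprD addrACA; apply: MD => //.
by rewrite -scalerA -scalerBr; apply: MZ.
Qed.

End Separation.

(* The tensor product of two modules is the type of finite formal sums of pairs,
   two sums being identified when every bilinear map takes the same value on
   both; this builds the universal property into the quotient. *)
Section TensorModule.
Variable K : fieldType.
Implicit Types U V W : lmodType K.

Definition bilin U V W (f : V -> W -> U) : Prop :=
  (forall w, linear (f^~ w)) /\ (forall v, linear (f v)).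

Definition formal_sum U V W (f : V -> W -> U) (s : seq (V * W)) : U :=
  \sum_(p <- s) f p.1 p.2.

Variables V W : lmodType K.
Implicit Types s t : seq (V * W).

Definition tensor_rel : rel (seq (V * W)) := fun s t =>
  `[< forall (U : lmodType K) (f : V -> W -> U), bilin f ->
        formal_sum f s = formal_sum f t >].

Lemma tensor_rel_equiv : equiv_class_of tensor_rel.
Proof.
split=> [s|s t|t s u].
- exact/asboolP.
- by apply/asboolP/asboolP => e U f bf; rewrite e.
- by move=> /asboolP e1 /asboolP e2; apply/asboolP => U f bf; rewrite e1 ?e2.
Qed.

Canonical tensor_rel_equivRel := EquivRelPack tensor_rel_equiv.
Canonical tensor_rel_encModRel := defaultEncModRel tensor_rel.

Definition tensor := {eq_quot tensor_rel}.

HB.instance Definition _ : EqQuotient _ tensor_rel tensor :=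
  EqQuotient.on tensor.
HB.instance Definition _ := Choice.on tensor.

Definition tens (v : V) (w : W) : tensor := \pi_tensor [:: (v, w)].

(* For bilinear f this is the linear map induced by f; Sweedler sums
   \sum f(h_(1), h_(2)) are written tlift f (coproduct h). *)
Definition tlift U (f : V -> W -> U) (x : tensor) : U := formal_sum f (repr x).

Implicit Types x y z : tensor.

Lemma tlift_pi U (f : V -> W -> U) s :
  bilin f -> tlift f (\pi_tensor s) = formal_sum f s.
Proof.
move=> bf; rewrite /tlift.
have /eqP : repr (\pi_tensor s) == s %[mod tensor] by rewrite reprK.
by move/eqP; rewrite piE => /asboolP /(_ U f bf).
Qed.

Lemma tensor_eqP x y :
  (forall U (f : V -> W -> U), bilin f -> tlift f x = tlift f y) -> x = y.
Proof.
move=> e; rewrite -[x]reprK -[y]reprK; apply/eqP; rewrite piE.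
exact/asboolP.
Qed.

Definition tens0 : tensor := \pi_tensor [::].
Definition tensN x : tensor := \pi_tensor [seq (- p.1, p.2) | p <- repr x].
Definition tensD x y : tensor := \pi_tensor (repr x ++ repr y).
Definition tensZ k x : tensor := \pi_tensor [seq (k *: p.1, p.2) | p <- repr x].

Let lift0 U (f : V -> W -> U) : bilin f -> tlift f tens0 = 0.
Proof. by move=> bf; rewrite tlift_pi // /formal_sum big_nil. Qed.

Let liftN U (f : V -> W -> U) x : bilin f -> tlift f (tensN x) = - tlift f x.
Proof.
move=> bf; rewrite tlift_pi // /formal_sum big_map -sumrN.
apply: eq_bigr => p _ /=; have := bf.1 p.2 (-1) p.1 0.
have := bf.1 p.2 1 0 0; rewrite !scale1r !addr0.
by move/(congr1 (+%R^~ (- f 0 p.2))); rewrite addrK subrr => <-; rewrite !scaleN1r !addr0.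
Qed.

Let liftD U (f : V -> W -> U) x y :
  bilin f -> tlift f (tensD x y) = tlift f x + tlift f y.
Proof. by move=> bf; rewrite tlift_pi // /formal_sum big_cat. Qed.

Let liftZ U (f : V -> W -> U) k x :
  bilin f -> tlift f (tensZ k x) = k *: tlift f x.
Proof.
move=> bf; rewrite tlift_pi // /formal_sum big_map scaler_sumr.
apply: eq_bigr => p _ /=; have := bf.1 p.2 k p.1 0.
have := bf.1 p.2 1 0 0; rewrite !scale1r !addr0.
by move/(congr1 (+%R^~ (- f 0 p.2))); rewrite addrK subrr => <-; rewrite addr0.
Qed.

Fact tensDA : associative tensD.
Proof. by move=> x y z; apply: tensor_eqP => U f bf; rewrite !liftD // addrA. Qed.

Fact tensDC : commutative tensD.
Proof. by move=> x y; apply: tensor_eqP => U f bf; rewrite !liftD // addrC. Qed.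

Fact tens0D : left_id tens0 tensD.
Proof. by move=> x; apply: tensor_eqP => U f bf; rewrite liftD // lift0 // add0r. Qed.

Fact tensND : left_inverse tens0 tensN tensD.
Proof.
move=> x; apply: tensor_eqP => U f bf.
by rewrite liftD // liftN // lift0 // addNr.
Qed.

HB.instance Definition _ :=
  GRing.isZmodule.Build tensor tensDA tensDC tens0D tensND.

Fact tensZA k l x : tensZ k (tensZ l x) = tensZ (k * l) x.
Proof. by apply: tensor_eqP => U f bf; rewrite !liftZ // scalerA. Qed.

Fact tens1Z : left_id 1 tensZ.
Proof. by move=> x; apply: tensor_eqP => U f bf; rewrite liftZ // scale1r. Qed.

Fact tensZDr : right_distributive tensZ +%R.
Proof.
move=> k x y; apply: tensor_eqP => U f bf.
by rewrite !(liftZ, liftD) // scalerDr.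
Qed.

Fact tensZDl x : {morph tensZ^~ x : k l / k + l}.
Proof.
move=> k l; apply: tensor_eqP => U f bf.
by rewrite !(liftZ, liftD) // scalerDl.
Qed.

HB.instance Definition _ :=
  GRing.Zmodule_isLmodule.Build K tensor tensZA tens1Z tensZDr tensZDl.

Lemma tlift_linear U (f : V -> W -> U) : bilin f -> linear (tlift f).
Proof. by move=> bf k x y; rewrite liftD // liftZ. Qed.

Lemma tlift_tens U (f : V -> W -> U) v w : bilin f -> tlift f (tens v w) = f v w.
Proof. by move=> bf; rewrite tlift_pi // /formal_sum big_seq1. Qed.

Lemma tens_bilin : bilin tens.
Proof.
split=> [w|v] k u u'; apply: tensor_eqP => U f bf;
  rewrite tlift_linear // !tlift_tens //.
  exact: bf.1.
exact: bf.2.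
Qed.

Lemma linear_morph0 (U U' : lmodType K) (f : U -> U') : linear f -> f 0 = 0.
Proof.
move=> lf; have := lf 1 0 0; rewrite !scale1r addr0.
by move/(congr1 (+%R^~ (- f 0))); rewrite addrK subrr.
Qed.

Lemma tensor_ext U (f g : tensor -> U) : linear f -> linear g ->
  (forall v w, f (tens v w) = g (tens v w)) -> f =1 g.
Proof.
move=> lf lg fg x; have pisum s : \pi_tensor s = \sum_(p <- s) tens p.1 p.2.
  apply: tensor_eqP => U' h bh; rewrite tlift_pi // /formal_sum.
  elim: s => [|p s IHs]; rewrite ?(big_nil, big_cons).
    by rewrite (linear_morph0 (tlift_linear bh)).
  by rewrite IHs -[tens _ _]scale1r tlift_linear // scale1r tlift_tens.
rewrite -[x]reprK pisum; elim: (repr x) => [|p s IHs].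
  by rewrite big_nil !linear_morph0.
by rewrite big_cons -[tens _ _]scale1r lf lg fg IHs.
Qed.

End TensorModule.

Notation "V ⊗ W" := (tensor V%type W%type) (at level 40, left associativity) : type_scope.
Notation "v ⊗ w" := (tens v w) (at level 40, left associativity) : ring_scope.

Section LinearityRules.
Variable K : fieldType.
Implicit Types U V W X : lmodType K.
Implicit Type A : algType K.

Lemma lin_id U : linear (fun x : U => x).
Proof. by []. Qed.

Lemma lin_comp U V W (f : V -> W) (g : U -> V) :
  linear f -> linear g -> linear (fun x => f (g x)).
Proof. by move=> lf lg k x y; rewrite lg lf. Qed.

Lemma lin_tensl U V W (f : U -> V) (w : W) :
  linear f -> linear (fun x => f x ⊗ w).
Proof. by move=> lf; apply: (lin_comp ((tens_bilin V W).1 w)). Qed.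

Lemma lin_tensr U V W (v : V) (f : U -> W) :
  linear f -> linear (fun x => v ⊗ f x).
Proof. by move=> lf; apply: (lin_comp ((tens_bilin V W).2 v)). Qed.

Lemma lin_mull U A (f : U -> A) a : linear f -> linear (fun x => f x * a).
Proof. by move=> lf k x y; rewrite lf mulrDl scalerAl. Qed.

Lemma lin_mulr U A a (f : U -> A) : linear f -> linear (fun x => a * f x).
Proof. by move=> lf k x y; rewrite lf mulrDr scalerAr. Qed.

Lemma lin_scalel U V (f : U -> K^o) (v : V) :
  linear f -> linear (fun x => (f x : K) *: v).
Proof. by move=> lf k x y; rewrite lf scalerDl -scalerA. Qed.

Lemma lin_scaler U V k (f : U -> V) : linear f -> linear (fun x => k *: f x).
Proof. by move=> lf l x y; rewrite lf scalerDr !scalerA mulrC. Qed.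

Lemma lin_tlift U V W X (F : X -> V -> W -> U) t :
  (forall v w, linear (fun x => F x v w)) -> linear (fun x => tlift (F x) t).
Proof.
move=> lF k x y; rewrite /tlift /formal_sum scaler_sumr -big_split.
by apply: eq_bigr => p _; apply: lF.
Qed.

End LinearityRules.

Ltac lin_step :=
  cbv beta;
  first
  [ assumption
  | match goal with
    | |- bilin _ => split => ?
    | H : bilin ?f |- GRing.linear_for _ (fun x => ?f x _) => exact: H.1
    | H : bilin ?f |- GRing.linear_for _ (fun x => ?f _ x) => exact: H.2
    | H : bilin ?f |- GRing.linear_for _ (?f _) => exact: H.2
    | H : bilin ?f |- GRing.linear_for _ (fun x => ?f (@?g x) ?w) =>
        apply: (@lin_comp _ _ _ _ (fun v => f v w) g)
    | H : bilin ?f |- GRing.linear_for _ (fun x => ?f ?v (@?g x)) =>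
        apply: (@lin_comp _ _ _ _ (f v) g)
    | |- GRing.linear_for _ (fun x => x) => apply: lin_id
    | |- GRing.linear_for _ (fun x => tens (@?f x) ?w) => apply: (@lin_tensl _ _ _ _ f w)
    | |- GRing.linear_for _ (fun x => tens ?v (@?f x)) => apply: (@lin_tensr _ _ _ _ v f)
    | |- GRing.linear_for _ (fun x => GRing.mul (@?f x) ?w) => apply: (@lin_mull _ _ _ f w)
    | |- GRing.linear_for _ (fun x => GRing.mul ?v (@?f x)) => apply: (@lin_mulr _ _ _ v f)
    | |- GRing.linear_for _ (fun x => GRing.scale ?v (@?f x)) => apply: (@lin_scaler _ _ _ v f)
    | |- GRing.linear_for _ (fun x => GRing.scale (@?f x) ?v) => apply: (@lin_scalel _ _ _ f v)
    | |- GRing.linear_for _ (fun x => tlift (@?F x) ?t) => apply: (@lin_tlift _ _ _ _ _ F t) => ? ?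
    | |- GRing.linear_for _ (fun x => tlift ?F (@?f x)) => apply: (@lin_comp _ _ _ _ (tlift F) f)
    | |- GRing.linear_for _ (tlift ?F) => apply: tlift_linear
    | |- GRing.linear_for _ (tens ?v) => exact: (tens_bilin _ _).2
    end
  | match goal with
    | |- GRing.linear_for _ _ => exact: linearP
    | |- GRing.linear_for _ (fun x => ?f (@?g x)) => apply: (@lin_comp _ _ _ _ f g)
    end ].
Ltac lin := solve [repeat lin_step].

Ltac tensor_ind x :=
  move: x; apply: tensor_ext; [lin | lin | cbv beta].

Section TensorAlgebra.
Variable K : fieldType.
Variables A B : algType K.

Definition tens_mul (x y : A ⊗ B) : A ⊗ B :=
  tlift (fun a b => tlift (fun a' b' => (a * a') ⊗ (b * b')) y) x.

Definition tens_one : A ⊗ B := 1 ⊗ 1.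

Lemma tens_mul_bilin : bilin tens_mul.
Proof. rewrite /tens_mul. lin. Qed.

Lemma tens_mulE a b a' b' :
  tens_mul (a ⊗ b) (a' ⊗ b') = (a * a') ⊗ (b * b').
Proof. rewrite /tens_mul !tlift_tens //; lin. Qed.

Fact tens_mulA : associative tens_mul.
Proof.
have bm := tens_mul_bilin => x y z.
tensor_ind x => a b; tensor_ind y => a' b'; tensor_ind z => a'' b''.
by rewrite !tens_mulE !mulrA.
Qed.

Fact tens_mul1l : left_id tens_one tens_mul.
Proof.
have bm := tens_mul_bilin => x; tensor_ind x => a b.
by rewrite tens_mulE !mul1r.
Qed.

Fact tens_mul1r : right_id tens_one tens_mul.
Proof.
have bm := tens_mul_bilin => x; tensor_ind x => a b.
by rewrite tens_mulE !mulr1.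
Qed.

Fact tens_mulDl : left_distributive tens_mul +%R.
Proof. by move=> x y z; have := tens_mul_bilin.1 z 1 x y; rewrite !scale1r. Qed.

Fact tens_mulDr : right_distributive tens_mul +%R.
Proof. by move=> x y z; have := tens_mul_bilin.2 x 1 y z; rewrite !scale1r. Qed.

Fact tens_one_neq0 : tens_one != 0.
Proof.
have [f lf f1] := separating_functional (oner_neq0 A).
have [g lg g1] := separating_functional (oner_neq0 B).
apply/eqP => /(congr1 (tlift (fun a b => (f a : K) *: g b))).
rewrite (linear_morph0 (tlift_linear _)); last by lin.
rewrite /tens_one tlift_tens; last by lin.
by rewrite f1 g1 scale1r => /eqP; rewrite oner_eq0.
Qed.

HB.instance Definition _ := GRing.Zmodule_isNzRing.Build (tensor A B)
  tens_mulA tens_mul1l tens_mul1r tens_mulDl tens_mulDr tens_one_neq0.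

Fact tens_scalerAl k (x y : A ⊗ B) : k *: (x * y) = k *: x * y.
Proof.
have := tens_mul_bilin.1 y k x 0; rewrite addr0 => e.
by apply/esym/(etrans e); rewrite -[tens_mul 0 y]/(0 * y) mul0r addr0.
Qed.

HB.instance Definition _ :=
  GRing.Lmodule_isLalgebra.Build K (tensor A B) tens_scalerAl.

Fact tens_scalerAr k (x y : A ⊗ B) : k *: (x * y) = x * (k *: y).
Proof.
have := tens_mul_bilin.2 x k y 0; rewrite addr0 => e.
by apply/esym/(etrans e); rewrite -[tens_mul x 0]/(x * 0) mulr0 addr0.
Qed.

HB.instance Definition _ :=
  GRing.Lalgebra_isAlgebra.Build K (tensor A B) tens_scalerAr.

Lemma tensM a b a' b' : (a ⊗ b) * (a' ⊗ b') = (a * a') ⊗ (b * b') :> A ⊗ B.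
Proof. exact: tens_mulE. Qed.

Lemma tens1 : 1 = 1 ⊗ 1 :> A ⊗ B.
Proof. by []. Qed.

End TensorAlgebra.

Section TensorMaps.
Variable K : fieldType.
Implicit Types U V W : lmodType K.

Definition tmap U V U' V' (f : U -> U') (g : V -> V') : U ⊗ V -> U' ⊗ V' :=
  tlift (fun u v => f u ⊗ g v).

Definition tassoc U V W : (U ⊗ V) ⊗ W -> U ⊗ (V ⊗ W) :=
  tlift (fun x w => tlift (fun u v => u ⊗ (v ⊗ w)) x).

(* Exchange of the two middle factors. *)
Definition tmid U V U' V' (x : U ⊗ U') (y : V ⊗ V') : (U ⊗ V) ⊗ (U' ⊗ V') :=
  tlift (fun u u' => tlift (fun v v' => (u ⊗ v) ⊗ (u' ⊗ v')) y) x.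

Lemma tmap_linear U V U' V' (f : U -> U') (g : V -> V') :
  linear f -> linear g -> linear (tmap f g).
Proof. move=> lf lg; rewrite /tmap; lin. Qed.

Lemma tmap_tens U V U' V' (f : U -> U') (g : V -> V') u v :
  linear f -> linear g -> tmap f g (u ⊗ v) = f u ⊗ g v.
Proof. by move=> lf lg; rewrite /tmap tlift_tens //; lin. Qed.

Lemma tassoc_linear U V W : linear (@tassoc U V W).
Proof. by rewrite /tassoc; lin. Qed.

Lemma tassoc_tens U V W (u : U) (v : V) (w : W) :
  tassoc ((u ⊗ v) ⊗ w) = u ⊗ (v ⊗ w).
Proof. by rewrite /tassoc !tlift_tens //; lin. Qed.

Lemma tmid_bilin U V U' V' : bilin (@tmid U V U' V').
Proof. by rewrite /tmid; lin. Qed.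

Lemma tmid_tens U V U' V' (u : U) (u' : U') (v : V) (v' : V') :
  tmid (u ⊗ u') (v ⊗ v') = (u ⊗ v) ⊗ (u' ⊗ v').
Proof. by rewrite /tmid !tlift_tens //; lin. Qed.

End TensorMaps.

HB.mixin Record Algebra_isHopf (K : fieldType) A of GRing.Algebra K A := {
  coproduct : {lrmorphism A -> A ⊗ A};
  counit : {lrmorphism A -> K^o};
  antipode : {linear A -> A};
  coproductA : forall h : A,
    tassoc (tmap coproduct id (coproduct h)) = tmap id coproduct (coproduct h);
  counitl : forall h : A,
    tlift (fun a b => (counit a : K) *: b) (coproduct h) = h;
  counitr : forall h : A,
    tlift (fun a b => (counit b : K) *: a) (coproduct h) = h;
  antipodel : forall h : A,
    tlift (fun a b => antipode a * b) (coproduct h) = (counit h : K) *: 1;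
  antipoder : forall h : A,
    tlift (fun a b => a * antipode b) (coproduct h) = (counit h : K) *: 1
}.

#[short(type="hopfAlgType")]
HB.structure Definition Hopf (K : fieldType) :=
  {A of GRing.Algebra K A & Algebra_isHopf K A}.

HB.mixin Record Hopf_hasInvAntipode (K : fieldType) A of Hopf K A := {
  antipodeV : A -> A;
  antipodeK : cancel (antipode : A -> A) antipodeV;
  antipodeVK : cancel antipodeV (antipode : A -> A)
}.

#[short(type="bijHopfAlgType")]
HB.structure Definition BijHopf (K : fieldType) :=
  {A of Hopf K A & Hopf_hasInvAntipode K A}.


Section LiftRules.
Variable K : fieldType.
Implicit Types U V W X : lmodType K.

Lemma tlift_tmap U V U' V' X (F : U' -> V' -> X) (f : U -> U') (g : V -> V') x :
  bilin F -> linear f -> linear g ->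
  tlift F (tmap f g x) = tlift (fun a b => F (f a) (g b)) x.
Proof.
move=> bF lf lg; have lfg := tmap_linear lf lg.
tensor_ind x => a b; rewrite tmap_tens // !tlift_tens //; lin.
Qed.

Lemma tlift_tassoc U V W X (F : U -> V ⊗ W -> X) x :
  bilin F ->
  tlift F (tassoc x) =
  tlift (fun y w => tlift (fun u v => F u (v ⊗ w)) y) x.
Proof.
move=> bF; have la := @tassoc_linear K U V W.
tensor_ind x => y w; rewrite tlift_tens; last by lin.
tensor_ind y => u v; rewrite tassoc_tens !tlift_tens //; lin.
Qed.

Lemma tlift_comp U V W X (h : W -> X) (F : U -> V -> W) x :
  linear h -> bilin F -> h (tlift F x) = tlift (fun a b => h (F a b)) x.
Proof.
by move=> lh bF; tensor_ind x => a b; rewrite !tlift_tens //; lin.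
Qed.

Lemma tensZl V W k (v : V) (w : W) : (k *: v) ⊗ w = k *: (v ⊗ w).
Proof.
have := (tens_bilin V W).1 w k v 0; rewrite addr0 => ->.
have l0 : linear (fun v : V => v ⊗ w) by lin.
by rewrite [0 ⊗ w](linear_morph0 l0) addr0.
Qed.

Lemma tensZr V W k (v : V) (w : W) : v ⊗ (k *: w) = k *: (v ⊗ w).
Proof.
have := (tens_bilin V W).2 v k w 0; rewrite addr0 => ->.
by rewrite (linear_morph0 ((tens_bilin V W).2 v)) addr0.
Qed.

Lemma eq_tlift U V X (F G : U -> V -> X) x :
  (forall a b, F a b = G a b) -> tlift F x = tlift G x.
Proof. by move=> FG; apply: eq_bigr => p _. Qed.

End LiftRules.

Section Convolution.
Variables (K : fieldType) (C : lmodType K) (A : algType K).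
Variable D : C -> C ⊗ C.
Hypothesis lD : linear D.
Hypothesis DA : forall c, tassoc (tmap D id (D c)) = tmap id D (D c).

Definition conv (f g : C -> A) (c : C) : A := tlift (fun a b => f a * g b) (D c).

Lemma conv_linear f g : linear f -> linear g -> linear (conv f g).
Proof. by move=> lf lg; rewrite /conv; lin. Qed.

Lemma convA f g h : linear f -> linear g -> linear h ->
  conv (conv f g) h =1 conv f (conv g h).
Proof.
move=> lf lg lh c; rewrite /conv.
pose F x b := tlift (fun a a' => f a * g a') x * h b.
have -> : tlift (fun a b => tlift (fun a' b' => f a' * g b') (D a) * h b) (D c)
          = tlift F (tmap D id (D c)) by rewrite tlift_tmap // /F; lin.
pose F' a x := f a * tlift (fun b b' => g b * h b') x.
have -> : tlift (fun a b => f a * tlift (fun a' b' => g a' * h b') (D b)) (D c)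
          = tlift F' (tmap id D (D c)) by rewrite tlift_tmap // /F'; lin.
rewrite -DA tlift_tassoc; last by rewrite /F'; lin.
apply: eq_tlift => x b; rewrite /F /F'; tensor_ind x => a a'.
by rewrite !tlift_tens ?mulrA //; lin.
Qed.

Lemma conv_inv_unique (e f g h : C -> A) : linear f -> linear g -> linear h ->
  conv g f =1 e -> conv f h =1 e ->
  (forall k, linear k -> conv e k =1 k) -> (forall k, linear k -> conv k e =1 k) ->
  g =1 h.
Proof.
move=> lf lg lh gf fh e1 e2 c.
rewrite -(e1 h lh) -(e2 g lg).
transitivity (conv g (conv f h) c).
  by apply: eq_tlift => a b; rewrite fh.
by rewrite -convA //; apply: eq_tlift => a b; rewrite gf.
Qed.

End Convolution.

Section TensorCoproduct.
Variable K : fieldType.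
Variables A B : hopfAlgType K.

Definition tens_coproduct (z : A ⊗ B) : (A ⊗ B) ⊗ (A ⊗ B) :=
  tlift (fun a b => tmid (coproduct a) (coproduct b)) z.

Definition tens_counit (z : A ⊗ B) : K^o :=
  tlift (fun a b => (counit a : K) *: (counit b : K^o)) z.

Lemma tens_coproduct_linear : linear tens_coproduct.
Proof.
have bm := @tmid_bilin K A B A B.
rewrite /tens_coproduct; lin.
Qed.

Lemma tens_coproduct_tens a b :
  tens_coproduct (a ⊗ b) = tmid (coproduct a) (coproduct b).
Proof.
have bm := @tmid_bilin K A B A B.
by rewrite /tens_coproduct tlift_tens //; lin.
Qed.

Lemma tens_counit_linear : linear tens_counit.
Proof. by rewrite /tens_counit; lin. Qed.

Lemma tens_counit_tens a b :
  tens_counit (a ⊗ b) = (counit a : K) * (counit b : K).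
Proof. by rewrite /tens_counit tlift_tens //; lin. Qed.

Fact tens_coproductA z :
  tassoc (tmap tens_coproduct id (tens_coproduct z)) =
  tmap id tens_coproduct (tens_coproduct z).
Proof.
have lD := tens_coproduct_linear.
have l1 : linear (tmap tens_coproduct (@id (A ⊗ B))) by exact: tmap_linear.
have l2 : linear (tmap (@id (A ⊗ B)) tens_coproduct) by exact: tmap_linear.
have l3 := @tassoc_linear K (A ⊗ B)%type (A ⊗ B)%type (A ⊗ B)%type.
tensor_ind z => a b; rewrite tens_coproduct_tens.
have bm := @tmid_bilin K A B A B.
have bm1 := @tmid_bilin K A B (A ⊗ A)%type (B ⊗ B)%type.
have bm2 := @tmid_bilin K (A ⊗ A)%type (B ⊗ B)%type A B.
have l4 := @tassoc_linear K A A A.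
have l5 := @tassoc_linear K B B B.
pose D1 : A ⊗ A -> _ := tmap coproduct id.
have lD1 : linear D1 by apply: tmap_linear; lin.
pose D1' : B ⊗ B -> _ := tmap coproduct id.
have lD1' : linear D1' by apply: tmap_linear; lin.
pose D2 : A ⊗ A -> _ := tmap id coproduct.
have lD2 : linear D2 by apply: tmap_linear; lin.
pose D2' : B ⊗ B -> _ := tmap id coproduct.
have lD2' : linear D2' by apply: tmap_linear; lin.
pose m1 : (A ⊗ A) ⊗ (B ⊗ B) -> _ := tlift (@tmid K A B A B).
have lm1 : linear m1 by exact: tlift_linear.
have lt1 : linear (tmap m1 (@id (A ⊗ B))) by exact: tmap_linear.
have lt2 : linear (tmap (@id (A ⊗ B)) m1) by exact: tmap_linear.
have e1 x y : tmap tens_coproduct id (tmid x y) =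
              tmap m1 id (tmid (D1 x) (D1' y)).
  tensor_ind x => a1 a2; tensor_ind y => b1 b2.
  rewrite tmid_tens tmap_tens // tens_coproduct_tens /D1 /D1'.
  rewrite !tmap_tens //; try lin.
  by rewrite tmid_tens tmap_tens // /m1 tlift_tens.
have e2 x y : tmap id tens_coproduct (tmid x y) =
              tmap id m1 (tmid (D2 x) (D2' y)).
  tensor_ind x => a1 a2; tensor_ind y => b1 b2.
  rewrite tmid_tens tmap_tens // tens_coproduct_tens /D2 /D2'.
  rewrite !tmap_tens //; try lin.
  by rewrite tmid_tens tmap_tens // /m1 tlift_tens.
have e3 x y : tassoc (tmap m1 id (tmid x y)) = 
              tmap id m1 (tmid (tassoc x) (tassoc y)).
  tensor_ind x => x a3; tensor_ind y => y b3.
  tensor_ind x => a1 a2; tensor_ind y => b1 b2.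
  rewrite tmid_tens tmap_tens // !tassoc_tens tmid_tens tmap_tens //.
  by rewrite /m1 !tlift_tens // !tmid_tens tassoc_tens.
by rewrite e1 e3 e2 /D1 /D1' !coproductA.
Qed.

Lemma tmidM (x x' : A ⊗ A) (y y' : B ⊗ B) :
  tmid (x * x') (y * y') = tmid x y * tmid x' y'.
Proof.
have bm := @tmid_bilin K A B A B.
tensor_ind x => a1 a2; tensor_ind x' => a1' a2'.
tensor_ind y => b1 b2; tensor_ind y' => b1' b2'.
by rewrite !(tensM, tmid_tens).
Qed.

Fact tens_coproduct_monoid : monoid_morphism tens_coproduct.
Proof.
split; first by rewrite tens1 tens_coproduct_tens !rmorph1 !tens1 tmid_tens.
have lD := tens_coproduct_linear.
move=> x y; tensor_ind x => a b; tensor_ind y => a' b'.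
by rewrite tensM !tens_coproduct_tens !rmorphM tmidM.
Qed.

Fact tens_counit_monoid : monoid_morphism tens_counit.
Proof.
split; first by rewrite tens1 tens_counit_tens !rmorph1 mulr1.
have lD := tens_counit_linear.
move=> x y; tensor_ind x => a b; tensor_ind y => a' b'.
by rewrite tensM !tens_counit_tens !rmorphM mulrACA.
Qed.

Fact tens_counitl z :
  tlift (fun x y => (tens_counit x : K) *: y) (tens_coproduct z) = z.
Proof.
have lD := tens_coproduct_linear; have le := tens_counit_linear.
have bm := @tmid_bilin K A B A B.
tensor_ind z => a b; rewrite tens_coproduct_tens.
rewrite -[in RHS](counitl a) -[in RHS](counitl b).
move: (coproduct a) (coproduct b) => x y.
tensor_ind x => a1 a2; tensor_ind y => b1 b2.
rewrite tmid_tens !tlift_tens; try lin.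
by rewrite tens_counit_tens tensZl tensZr scalerA.
Qed.

Fact tens_counitr z :
  tlift (fun x y => (tens_counit y : K) *: x) (tens_coproduct z) = z.
Proof.
have lD := tens_coproduct_linear; have le := tens_counit_linear.
have bm := @tmid_bilin K A B A B.
tensor_ind z => a b; rewrite tens_coproduct_tens.
rewrite -[in RHS](counitr a) -[in RHS](counitr b).
move: (coproduct a) (coproduct b) => x y.
tensor_ind x => a1 a2; tensor_ind y => b1 b2.
rewrite tmid_tens !tlift_tens; try lin.
by rewrite tens_counit_tens tensZl tensZr scalerA.
Qed.

HB.instance Definition _ :=
  GRing.isLinear.Build K (tensor A B) (tensor (tensor A B) (tensor A B)) _
    tens_coproduct tens_coproduct_linear.
HB.instance Definition _ :=
  GRing.isMonoidMorphism.Build (tensor A B) (tensor (tensor A B) (tensor A B))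
    tens_coproduct tens_coproduct_monoid.
HB.instance Definition _ :=
  GRing.isLinear.Build K (tensor A B) K^o _ tens_counit tens_counit_linear.
HB.instance Definition _ :=
  GRing.isMonoidMorphism.Build (tensor A B) K^o tens_counit tens_counit_monoid.

Definition tens_antipode : A ⊗ B -> A ⊗ B := tmap antipode antipode.

Lemma tens_antipode_linear : linear tens_antipode.
Proof. by apply: tmap_linear; lin. Qed.

Lemma tens_antipode_tens a b :
  tens_antipode (a ⊗ b) = antipode a ⊗ antipode b.
Proof. by rewrite /tens_antipode tmap_tens //; lin. Qed.

HB.instance Definition _ :=
  GRing.isLinear.Build K (tensor A B) (tensor A B) _
    tens_antipode tens_antipode_linear.

Fact tens_antipodel z :
  tlift (fun x y => tens_antipode x * y) (tens_coproduct z) =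
  (tens_counit z : K) *: 1.
Proof.
have bm := @tmid_bilin K A B A B.
tensor_ind z => a b; rewrite tens_coproduct_tens tens_counit_tens.
rewrite -scalerA tens1 -tensZr -tensZl -!antipodel.
move: (coproduct a) (coproduct b) => x y.
tensor_ind x => a1 a2; tensor_ind y => b1 b2.
rewrite tmid_tens !tlift_tens; try lin.
by rewrite tens_antipode_tens tensM.
Qed.

Fact tens_antipoder z :
  tlift (fun x y => x * tens_antipode y) (tens_coproduct z) =
  (tens_counit z : K) *: 1.
Proof.
have bm := @tmid_bilin K A B A B.
tensor_ind z => a b; rewrite tens_coproduct_tens tens_counit_tens.
rewrite -scalerA tens1 -tensZr -tensZl -!antipoder.
move: (coproduct a) (coproduct b) => x y.
tensor_ind x => a1 a2; tensor_ind y => b1 b2.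
rewrite tmid_tens !tlift_tens; try lin.
by rewrite tens_antipode_tens tensM.
Qed.

HB.instance Definition _ := Algebra_isHopf.Build K (tensor A B)
  tens_coproductA tens_counitl tens_counitr tens_antipodel tens_antipoder.

End TensorCoproduct.

Section Antipode.
Variables (K : fieldType) (A : hopfAlgType K).

Definition tmulr (x : A ⊗ A) : A := tlift (fun a b => a * b) x.

Definition tmulr_unit (x : A ⊗ A) : A := (tens_counit x : K) *: 1.

Lemma antipode1 : antipode (1 : A) = 1.
Proof.
have := antipodel (1 : A); rewrite !rmorph1 tens1 tlift_tens; last by lin.
by rewrite mulr1 scale1r.
Qed.

Lemma antipodeM (a b : A) : antipode (a * b) = antipode b * antipode a.
Proof.
have bm := @tmid_bilin K A A A A.
have lm : linear tmulr by rewrite /tmulr; lin.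
pose g x := antipode (tmulr x).
pose h (x : A ⊗ A) : A := tlift (fun a b => antipode b * antipode a) x.
have lg : linear g by rewrite /g; lin.
have lh : linear h by rewrite /h; lin.
have lD : linear (@tens_coproduct K A A) by exact: linearP.
have lu : linear tmulr_unit by rewrite /tmulr_unit; lin.
have -> : antipode (a * b) = g (a ⊗ b) by rewrite /g /tmulr tlift_tens //; lin.
have -> : antipode b * antipode a = h (a ⊗ b) by rewrite /h tlift_tens //; lin.
apply: (conv_inv_unique lD (@tens_coproductA K A A) lm lg lh
         (e := tmulr_unit)); rewrite /conv => //.
- have key x y : tlift (fun u v => g u * tmulr v) (tmid x y) =
                 tlift (fun c d => antipode c * d) (x * y : A ⊗ A).
    tensor_ind x => a1 a2; tensor_ind y => b1 b2.
    rewrite tmid_tens tensM !tlift_tens; try lin.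
    by rewrite /g /tmulr !tlift_tens //; lin.
  move=> z; tensor_ind z => {}a {}b.
  by rewrite tens_coproduct_tens key -rmorphM antipodel rmorphM
             /tmulr_unit tens_counit_tens.
- have key x y : tlift (fun u v => tmulr u * h v) (tmid x y) =
     tlift (fun c d => c * tlift (fun p q => p * antipode q) y * antipode d) x.
    tensor_ind x => a1 a2; tensor_ind y => b1 b2.
    rewrite tmid_tens !tlift_tens; try lin.
    by rewrite /h /tmulr !tlift_tens ?mulrA //; lin.
  move=> z; tensor_ind z => {}a {}b.
  rewrite tens_coproduct_tens key antipoder /tmulr_unit tens_counit_tens.
  rewrite mulrC -scalerA -(antipoder a) (tlift_comp (h := fun x => (counit b : K) *: x)); try lin.
  by apply: eq_tlift => a1 a2; rewrite -scalerAr mulr1 scalerAl.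
- move=> k lk z; rewrite -[in RHS](tens_counitl z).
  rewrite (tlift_comp (h := k)); try lin.
  by apply: eq_tlift => x y; rewrite /tmulr_unit -scalerAl mul1r -[_ *: y]addr0 lk (linear_morph0 lk) addr0.
- move=> k lk z; rewrite -[in RHS](tens_counitr z).
  rewrite (tlift_comp (h := k)); try lin.
  by apply: eq_tlift => x y; rewrite /tmulr_unit -scalerAr mulr1 -[_ *: x]addr0 lk (linear_morph0 lk) addr0.
Qed.

End Antipode.

Section InverseAntipode.
Variables (K : fieldType) (A : bijHopfAlgType K).

Lemma antipodeV_linear : linear (antipodeV : A -> A).
Proof.
move=> k x y; apply: (can_inj (@antipodeK K A)).
by rewrite linearP /= !antipodeVK.
Qed.

HB.instance Definition _ :=
  GRing.isLinear.Build K A A _ antipodeV antipodeV_linear.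

Lemma antipodeVM (a b : A) : antipodeV (a * b) = antipodeV b * antipodeV a.
Proof.
by apply: (can_inj (@antipodeK K A)); rewrite antipodeM !antipodeVK.
Qed.

Lemma antipodeV1 : antipodeV (1 : A) = 1.
Proof. by rewrite -[in LHS](@antipode1 K A) antipodeK. Qed.

End InverseAntipode.

Section TensorBijHopf.
Variables (K : fieldType) (A B : bijHopfAlgType K).

Definition tens_antipodeV : A ⊗ B -> A ⊗ B := tmap antipodeV antipodeV.

Fact tens_antipodeK : cancel (antipode : A ⊗ B -> A ⊗ B) tens_antipodeV.
Proof.
have lV : linear tens_antipodeV by apply: tmap_linear; lin.
move=> x; tensor_ind x => a b.
rewrite [antipode _]tens_antipode_tens /tens_antipodeV tmap_tens; try lin.
by rewrite !antipodeK.
Qed.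

Fact tens_antipodeVK : cancel tens_antipodeV (antipode : A ⊗ B -> A ⊗ B).
Proof.
have lV : linear tens_antipodeV by apply: tmap_linear; lin.
move=> x; tensor_ind x => a b.
rewrite /tens_antipodeV tmap_tens; try lin.
by rewrite [antipode _]tens_antipode_tens !antipodeVK.
Qed.

HB.instance Definition _ := Hopf_hasInvAntipode.Build K (tensor A B)
  tens_antipodeK tens_antipodeVK.

End TensorBijHopf.

HB.instance Definition _ (K : fieldType) (V : lmodType K) :=
  GRing.Lmodule.on V^c.

Section OppositeAlgebra.
Variables (K : fieldType) (A : algType K).

Fact opp_scalerAl k (x y : A^c) :
  k *: (x * y : A^c) = ((k *: x : A^c) * y : A^c).
Proof. exact: (@scalerAr K A k y x). Qed.

HB.instance Definition _ :=
  GRing.Lmodule_isLalgebra.Build K A^c opp_scalerAl.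

Fact opp_scalerAr k (x y : A^c) :
  k *: (x * y : A^c) = (x * (k *: y : A^c) : A^c).
Proof. exact: (@scalerAl K A k y x). Qed.

HB.instance Definition _ :=
  GRing.Lalgebra_isAlgebra.Build K A^c opp_scalerAr.

End OppositeAlgebra.

(* On A^c, the antipode is the inverse of the antipode of A. *)
Section OppositeHopf.
Variables (K : fieldType) (A : bijHopfAlgType K).

Definition opp_coproduct : A^c -> A^c ⊗ A^c := @coproduct K A.
Definition opp_counit : A^c -> K^o := @counit K A.
Definition opp_antipode : A^c -> A^c := @antipodeV K A.

Fact opp_coproduct_linear : linear opp_coproduct.
Proof. exact: (@linearP K A (tensor A A) _ coproduct). Qed.
Fact opp_counit_linear : linear opp_counit.
Proof. exact: (@linearP K A K^o _ counit). Qed.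
Fact opp_antipode_linear : linear opp_antipode.
Proof. exact: (@linearP K A A _ antipodeV). Qed.

Lemma opp_tens_mul (x y : A ⊗ A) :
  @tens_mul K A^c A^c x y = @tens_mul K A A y x.
Proof. exact: exchange_big. Qed.

Fact opp_coproduct_monoid : monoid_morphism opp_coproduct.
Proof.
split; first exact: (rmorph1 (@coproduct K A)).
move=> x y; apply: etrans (esym (opp_tens_mul _ _)).
exact: (rmorphM (@coproduct K A) y x).
Qed.

Fact opp_counit_monoid : monoid_morphism opp_counit.
Proof.
split; first exact: (rmorph1 (@counit K A)).
move=> x y; rewrite mulrC; exact: (rmorphM (@counit K A) y x).
Qed.

HB.instance Definition _ :=
  GRing.isLinear.Build K A^c (tensor A^c A^c) _
    opp_coproduct opp_coproduct_linear.
HB.instance Definition _ :=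
  GRing.isMonoidMorphism.Build A^c (tensor A^c A^c)
    opp_coproduct opp_coproduct_monoid.
HB.instance Definition _ :=
  GRing.isLinear.Build K A^c K^o _ opp_counit opp_counit_linear.
HB.instance Definition _ :=
  GRing.isMonoidMorphism.Build A^c K^o opp_counit opp_counit_monoid.
HB.instance Definition _ :=
  GRing.isLinear.Build K A^c A^c _ opp_antipode opp_antipode_linear.

Fact opp_coproductA (h : A^c) :
  tassoc (tmap opp_coproduct id (opp_coproduct h)) =
  tmap id opp_coproduct (opp_coproduct h).
Proof. exact: (@coproductA K A h). Qed.

Fact opp_counitl (h : A^c) :
  tlift (fun a b => (opp_counit a : K) *: b) (opp_coproduct h) = h.
Proof. exact: (@counitl K A h). Qed.

Fact opp_counitr (h : A^c) :
  tlift (fun a b => (opp_counit b : K) *: a) (opp_coproduct h) = h.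
Proof. exact: (@counitr K A h). Qed.

Lemma antipodeV_flipl (h : A) :
  tlift (fun a b => b * antipodeV a) (coproduct h) = (counit h : K) *: 1.
Proof.
apply: (can_inj (@antipodeK K A)); rewrite linearZ /= antipode1 -antipoder.
rewrite (tlift_comp (h := antipode)); try lin.
by apply: eq_tlift => a b; rewrite antipodeM antipodeVK.
Qed.

Lemma antipodeV_flipr (h : A) :
  tlift (fun a b => antipodeV b * a) (coproduct h) = (counit h : K) *: 1.
Proof.
apply: (can_inj (@antipodeK K A)); rewrite linearZ /= antipode1 -antipodel.
rewrite (tlift_comp (h := antipode)); try lin.
by apply: eq_tlift => a b; rewrite antipodeM antipodeVK.
Qed.

Fact opp_antipodel (h : A^c) :
  tlift (fun a b => (opp_antipode a * b : A^c)) (opp_coproduct h) =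
  (opp_counit h : K) *: (1 : A^c).
Proof. exact: antipodeV_flipl. Qed.

Fact opp_antipoder (h : A^c) :
  tlift (fun a b => (a * opp_antipode b : A^c)) (opp_coproduct h) =
  (opp_counit h : K) *: (1 : A^c).
Proof. exact: antipodeV_flipr. Qed.

HB.instance Definition _ := Algebra_isHopf.Build K A^c
  opp_coproductA opp_counitl opp_counitr opp_antipodel opp_antipoder.

HB.instance Definition _ := Hopf_hasInvAntipode.Build K A^c
  (@antipodeVK K A) (@antipodeK K A).

End OppositeHopf.

Section ModularPairs.
Variables (K : fieldType) (A : hopfAlgType K).

Definition group_like (s : A) : Prop :=
  coproduct s = s ⊗ s /\ (counit s : K) = 1.

Definition character (d : A -> K^o) : Prop := linear d /\ monoid_morphism d.

Definition modular_pair (d : A -> K^o) (s : A) : Prop :=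
  [/\ character d, group_like s & d s = 1].

Definition twisted_antipode (d : A -> K^o) (h : A) : A :=
  tlift (fun a b => (d a : K) *: antipode b) (coproduct h).

(* An algType has no inverse operation; s' is the (unique) two-sided
   inverse of s. *)
Definition in_involution (d : A -> K^o) (s : A) : Prop :=
  exists s' : A, [/\ s' * s = 1, s * s' = 1 &
    forall h, s' * twisted_antipode d (s' * twisted_antipode d h) = h].

End ModularPairs.

Record hopf_action (K : fieldType) (A : hopfAlgType K) (B : algType K) :=
  HopfAction {
    hact :> A -> B -> B;
    hact_bilin : bilin hact;
    hact_comp : forall h1 h2 a, hact h1 (hact h2 a) = hact (h1 * h2) a;
    hact_mul : forall h a b,
      hact h (a * b) = tlift (fun h1 h2 => hact h1 a * hact h2 b) (coproduct h)
  }.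

Section InvariantTraces.
Variables (K : fieldType) (A : hopfAlgType K) (B : algType K).
Variable act : hopf_action A B.

Definition sigma_trace (s : A) (t : B -> K^o) : Prop :=
  linear t /\ forall a b, t (a * b) = t (b * act s a).

Definition delta_invariant (d : A -> K^o) (t : B -> K^o) : Prop :=
  forall h a b, t (act h a * b) = t (a * act (twisted_antipode d h) b).

End InvariantTraces.

(* The dual is a Hopf algebra of linear functionals on H, separating the points
   of H, whose operations are the transposes of those of H. It need not contain
   every functional: on an infinite-dimensional H the transpose of the product
   does not map the full linear dual to its algebraic tensor square. *)
Record hopf_dual (K : fieldType) (H : bijHopfAlgType K) := HopfDual {
  dual_sort :> bijHopfAlgType K;
  dual_eval : dual_sort -> H -> K^o;
  dual_eval_bilin : bilin dual_eval;
  dual_eval_inj : forall w, (forall x, dual_eval w x = 0) -> w = 0;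
  dual_eval_sep : forall x, (forall w, dual_eval w x = 0) -> x = 0;
  dual_eval_mul : forall w1 w2 x,
    dual_eval (w1 * w2) x =
    tlift (fun a b => (dual_eval w1 a : K) *: dual_eval w2 b) (coproduct x);
  dual_eval_one : forall x, dual_eval 1 x = counit x;
  dual_eval_coproduct : forall w x y,
    tlift (fun w1 w2 => (dual_eval w1 x : K) *: dual_eval w2 y) (coproduct w) =
    dual_eval w (x * y);
  dual_eval_counit : forall w : dual_sort, counit w = dual_eval w 1;
  dual_eval_antipode : forall w x, dual_eval (antipode w) x =
                                   dual_eval w (antipode x)
}.

Section CanonicalAction.
Variables (K : fieldType) (H : bijHopfAlgType K) (Hd : hopf_dual H).
Local Notation ev := (@dual_eval K H Hd).

Let bev := @dual_eval_bilin K H Hd.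

Definition lact (w : Hd) (x : H) : H :=
  tlift (fun a b => (ev w a : K) *: b) (coproduct x).

Definition ract (x : H) (w : Hd) : H :=
  tlift (fun a b => (ev w b : K) *: a) (coproduct x).

Definition Htilde : bijHopfAlgType K := (Hd^c ⊗ Hd)%type.

Definition canonical_act (h : Htilde) (x : H) : H :=
  tlift (fun (w1 : Hd^c) (w2 : Hd) => ract (lact w1 x) w2) h.

Lemma lact_bilin : bilin lact.
Proof. have b := bev; rewrite /lact; lin. Qed.

Lemma ract_bilin : bilin ract.
Proof. have b := bev; rewrite /ract; lin. Qed.

Let morphZ (f : H -> H) k x : linear f -> f ((k : K) *: x) = k *: f x.
Proof. by move=> lf; rewrite -[_ *: x]addr0 lf (linear_morph0 lf) addr0. Qed.

Lemma lactM w w' x : lact (w' * w) x = lact w (lact w' x).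
Proof.
have b := bev; have bl := lact_bilin; have lw : linear (lact w) by lin.
pose F (a : H) (y : H ⊗ H) : H :=
  (ev w' a : K) *: tlift (fun b c => (ev w b : K) *: c) y.
pose G (y : H ⊗ H) (c : H) : H :=
  (tlift (fun a b => (ev w' a : K) *: (ev w b : K^o)) y : K) *: c.
have -> : lact w (lact w' x) = tlift F (tmap id coproduct (coproduct x)).
  rewrite [lact w' x]/lact (tlift_comp (h := lact w)) ?tlift_tmap /F //; try lin.
  by apply: eq_tlift => a c; rewrite morphZ.
have -> : lact (w' * w) x = tlift G (tmap coproduct id (coproduct x)).
  rewrite tlift_tmap /G; try lin.
  by apply: eq_tlift => a c; rewrite dual_eval_mul.
rewrite -coproductA tlift_tassoc /F; last by lin.
apply: eq_tlift => y c; rewrite /G; tensor_ind y => a1 a2.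
by rewrite !tlift_tens ?scalerA //; lin.
Qed.

Lemma ractM w w' x : ract x (w * w') = ract (ract x w') w.
Proof.
have b := bev; have br := ract_bilin; have lw : linear (ract^~ w) by lin.
pose F (y : H ⊗ H) (c : H) : H :=
  (ev w' c : K) *: tlift (fun a b => (ev w b : K) *: a) y.
pose G (a : H) (y : H ⊗ H) : H :=
  (tlift (fun b c => (ev w b : K) *: (ev w' c : K^o)) y : K) *: a.
have -> : ract (ract x w') w = tlift F (tmap coproduct id (coproduct x)).
  rewrite [ract x w']/ract (tlift_comp (h := ract^~ w)) ?tlift_tmap /F //; try lin.
  by apply: eq_tlift => a c; rewrite (morphZ (f := ract^~ w)).
have -> : ract x (w * w') = tlift G (tmap id coproduct (coproduct x)).
  rewrite tlift_tmap /G; try lin.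
  by apply: eq_tlift => a c; rewrite dual_eval_mul.
rewrite -coproductA tlift_tassoc /G; last by lin.
apply: eq_tlift => y c; rewrite /F; tensor_ind y => a1 a2.
by rewrite !tlift_tens ?scalerA; try lin; rewrite mulrC.
Qed.

Lemma lact_ract w w' x : ract (lact w x) w' = lact w (ract x w').
Proof.
have b := bev; have bl := lact_bilin; have br := ract_bilin.
have lw : linear (lact w) by lin.
have rw : linear (ract^~ w') by lin.
pose F (a : H) (y : H ⊗ H) : H :=
  (ev w a : K) *: tlift (fun b c => (ev w' c : K) *: b) y.
pose G (y : H ⊗ H) (c : H) : H :=
  (ev w' c : K) *: tlift (fun a b => (ev w a : K) *: b) y.
have -> : ract (lact w x) w' = tlift F (tmap id coproduct (coproduct x)).
  rewrite [lact w x]/lact (tlift_comp (h := ract^~ w')) ?tlift_tmap /F //; try lin.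
  by apply: eq_tlift => a c; rewrite (morphZ (f := ract^~ w')).
have -> : lact w (ract x w') = tlift G (tmap coproduct id (coproduct x)).
  rewrite [ract x w']/ract (tlift_comp (h := lact w)) ?tlift_tmap /G //; try lin.
  by apply: eq_tlift => a c; rewrite morphZ.
rewrite -coproductA tlift_tassoc /F; last by lin.
apply: eq_tlift => y c; rewrite /G; tensor_ind y => a1 a2.
by rewrite !tlift_tens ?scalerA; try lin; rewrite mulrC.
Qed.

Lemma lact_mul w x y :
  lact w (x * y) = tlift (fun w1 w2 => lact w1 x * lact w2 y) (coproduct w).
Proof.
have b := bev; rewrite /lact rmorphM /=.
move: (coproduct x) (coproduct y) => u v.
tensor_ind u => a1 a2; tensor_ind v => b1 b2.
rewrite tensM tlift_tens -?dual_eval_coproduct; try lin.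
rewrite (tlift_comp (h := fun k : K^o => (k : K) *: (a2 * b2))); try lin.
apply: eq_tlift => w1 w2; rewrite !tlift_tens; try lin.
by rewrite -scalerAl -scalerAr scalerA.
Qed.

Lemma ract_mul w x y :
  ract (x * y) w = tlift (fun w1 w2 => ract x w1 * ract y w2) (coproduct w).
Proof.
have b := bev; rewrite /ract rmorphM /=.
move: (coproduct x) (coproduct y) => u v.
tensor_ind u => a1 a2; tensor_ind v => b1 b2.
rewrite tensM tlift_tens -?dual_eval_coproduct; try lin.
rewrite (tlift_comp (h := fun k : K^o => (k : K) *: (a1 * b1))); try lin.
apply: eq_tlift => w1 w2; rewrite !tlift_tens; try lin.
by rewrite -scalerAl -scalerAr scalerA.
Qed.

Fact canonical_act_bilin : bilin canonical_act.
Proof.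
have bl := lact_bilin; have br := ract_bilin; rewrite /canonical_act.
split=> [x|h].
  apply: (@tlift_linear K Hd^c Hd H (fun w1 w2 => ract (lact w1 x) w2)).
  by split=> [w k u v|w]; [exact: (lin_comp (br.1 w) (bl.1 x)) | lin].
by apply: (@lin_tlift K H Hd^c Hd H) => v w; lin.
Qed.

Lemma canonical_act_tens (w1 w2 : Hd) x :
  canonical_act ((w1 : Hd^c) ⊗ w2) x = ract (lact w1 x) w2.
Proof.
have bl := lact_bilin; have br := ract_bilin.
rewrite /canonical_act tlift_tens //.
by split=> [w k u v|w]; [exact: (lin_comp (br.1 w) (bl.1 x)) | lin].
Qed.

Fact canonical_act_comp (h1 h2 : Htilde) x :
  canonical_act h1 (canonical_act h2 x) = canonical_act (h1 * h2) x.
Proof.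
have bc := canonical_act_bilin.
tensor_ind h1 => w1 w1'; tensor_ind h2 => w2 w2'.
rewrite (@tensM K Hd^c Hd) !canonical_act_tens.
by rewrite -lact_ract -ractM -lactM.
Qed.

Fact canonical_act_mul (h : Htilde) x y :
  canonical_act h (x * y) =
  tlift (fun h1 h2 => canonical_act h1 x * canonical_act h2 y) (coproduct h).
Proof.
have bc := canonical_act_bilin.
have bl := lact_bilin; have br := ract_bilin.
have blc : @bilin K H Hd^c H lact := bl.
have bm := @tmid_bilin K Hd^c Hd Hd^c Hd.
have key (X : Hd^c ⊗ Hd^c) (Y : Hd ⊗ Hd) :
    tlift (fun h1 h2 : Htilde => canonical_act h1 x * canonical_act h2 y)
      (tmid X Y) =
    tlift (fun w1 w2 : Hd^c => tlift (fun w1' w2' : Hd =>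
      ract (lact w1 x) w1' * ract (lact w2 y) w2') Y) X.
  tensor_ind X => w1 w2; tensor_ind Y => w1' w2'.
  rewrite tmid_tens !tlift_tens; try lin.
  by rewrite !canonical_act_tens.
have lD : linear (coproduct : Htilde -> Htilde ⊗ Htilde) by exact: linearP.
tensor_ind h => w w'.
have eD : coproduct (((w : Hd^c) ⊗ w') : Htilde) =
  tmid (coproduct (w : Hd^c)) (coproduct w') by exact: tens_coproduct_tens.
rewrite canonical_act_tens lact_mul eD key.
rewrite (tlift_comp (h := ract^~ w')); try lin.
by apply: eq_tlift => w1 w2; rewrite ract_mul.
Qed.

Definition canonical_action : hopf_action Htilde H :=
  HopfAction canonical_act_bilin canonical_act_comp canonical_act_mul.
End CanonicalAction.


Section QuantumGroup.
Variables (R : realType) (H : bijHopfAlgType R[i]) (Hd : hopf_dual H).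
Local Notation C := R[i].

(* slicer p and slicel p are the maps I ⊗ p and p ⊗ I. *)
Definition slicer (p : H -> C^o) (z : H ⊗ H) : H :=
  tlift (fun a b => (p b : C) *: a) z.

Definition slicel (p : H -> C^o) (z : H ⊗ H) : H :=
  tlift (fun a b => (p a : C) *: b) z.

Definition left_invariant (phi : H -> C^o) : Prop :=
  forall x y : H, slicer phi ((1 ⊗ x) * coproduct y) =
                  antipode (slicer phi (coproduct x * (1 ⊗ y))).

Definition right_invariant (psi : H -> C^o) : Prop :=
  forall x y : H, slicel psi (coproduct x * (y ⊗ 1)) =
                  antipode (slicel psi ((x ⊗ 1) * coproduct y)).

Record left_haar_weight (phi : H -> C^o) : Prop := {
  haar_linear : linear phi;
  haar_neq0 : exists x, phi x <> 0;
  haar_invariant : left_invariant phi;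
  haar_unique : forall phi' : H -> C^o, linear phi' -> left_invariant phi' ->
    exists c : C, forall x, phi' x = c * phi x
}.

(* The parameter t ranges over all complex numbers (analytic continuation); the
   weight phi is a mere linear functional. *)
Record modular_group (phi : H -> C^o) (s : C -> H -> H) : Prop := {
  modular_linear : forall t, linear (s t);
  modular_multiplicative : forall t, monoid_morphism (s t);
  modular_bijective : forall t, bijective (s t);
  modular0 : forall x, s 0 x = x;
  modularD : forall t u x, s (t + u) x = s t (s u x);
  modular_invariant : forall t x, phi (s t x) = phi x;
  modular_KMS : forall x y, phi (x * y) = phi (s 'i%C y * x)
}.

Definition complex_powers (A : hopfAlgType C) (d : A) (dpow : C -> A) : Prop :=
  [/\ forall z, group_like (dpow z),
      forall z w, dpow z * dpow w = dpow (z + w) & dpow 1 = d].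

Definition right_haar (phi : H -> C^o) (x : H) : C^o := phi (antipodeV x).

(* x |-> delta^z (sigma^w . x . sigma^w) delta^-z *)
Definition modular_formula (dpow : C -> H) (spow : C -> Hd) (z w : C) (x : H) :
    H :=
  dpow z * ract (lact (spow w) x) (spow w) * dpow (- z).

Record lc_quantum_group (phi : H -> C^o) (delta : H) (dpow : C -> H)
    (sigma : Hd) (spow : C -> Hd) (mphi mpsi : C -> H -> H) : Prop := {
  qg_left_haar : left_haar_weight phi;
  qg_right_haar : right_invariant (right_haar phi);
  qg_delta_powers : complex_powers delta dpow;
  qg_delta : forall x,
    slicer (right_haar phi) (coproduct x) = (right_haar phi x : C) *: delta;
  qg_phi_psi : forall x, phi x = right_haar phi (dpow 2^-1 * x * dpow 2^-1);
  qg_sigma_powers : complex_powers sigma spow;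
  qg_modular_phi : modular_group phi mphi;
  qg_modular_psi : modular_group (right_haar phi) mpsi;
  qg_modular_phiE : forall t x,
    mphi t x = modular_formula dpow spow ('i%C * t / 2) ('i%C * t / 2) x;
  qg_modular_psiE : forall t x,
    mpsi t x = modular_formula dpow spow (- ('i%C * t / 2)) ('i%C * t / 2) x
}.

Definition delta_tilde (dpow : C -> H) (h : Htilde Hd) : C^o :=
  tlift (fun (w1 : Hd^c) (w2 : Hd) =>
    (dual_eval (w1 : Hd) (dpow 2^-1) : C) *: dual_eval w2 (dpow (- 2^-1))) h.

Definition sigma_tilde (spow : C -> Hd) : Htilde Hd :=
  (spow 2^-1 : Hd^c) ⊗ spow 2^-1.

Definition midweight (phi : H -> C^o) (dpow : C -> H) (x : H) : C^o :=
  phi (dpow (- 4^-1) * x * dpow (- 4^-1)).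

End QuantumGroup.

(* Main.v *)
(* Writing w.y and y.w for the actions of the dual, invariance of the Haar weights
   says phi(x (w.y)) = phi((S(w).x) y) and psi((x.w) y) = psi(x (y.S(w))). Moving
   powers of delta across these identities gives the invariance of the midweight,
   and the KMS condition gives its trace property. For the involution, phi is
   faithful, so combining its invariance with the KMS condition yields
   sigma_i(w.y) = S^2(w).sigma_i(y); applying the counit gives
     S^2(x) = delta^(1/2) (sigma^(1/2).x.sigma^(-1/2)) delta^(-1/2).
   Hence the two legs of sigma_tilde^-1 S_delta_tilde square to the mutually
   inverse scalars <sigma^(-1/2), delta^(1/2)> and <sigma^(-1/2), delta^(-1/2)>. *)
From HB Require Import structures.
From mathcomp Require Import all_boot all_order all_algebra.
From mathcomp Require Import boolp reals complex.
Require Import Defs.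

Set Implicit Arguments.
Unset Strict Implicit.
Unset Printing Implicit Defensive.

Import GRing.Theory Num.Theory.
Local Open Scope ring_scope.

(** * Maps known only through a proof of [linear] *)

Section LinearFunctions.
Variables (K : fieldType) (V W : lmodType K) (f : V -> W).
Hypothesis lf : linear f.

Lemma lin_sum (I : Type) (r : seq I) (a : I -> V) :
  f (\sum_(i <- r) a i) = \sum_(i <- r) f (a i).
Proof.
elim: r => [|i r IHr]; first by rewrite !big_nil (linear_morph0 lf).
by rewrite !big_cons -IHr -[a i in LHS]scale1r lf scale1r.
Qed.

Lemma lin_scale k v : f (k *: v) = k *: f v.
Proof. by have := lf k v 0; rewrite addr0 (linear_morph0 lf) addr0. Qed.

Lemma lin_sub u v : f (u - v) = f u - f v.
Proof. by rewrite addrC -scaleN1r lf scaleN1r addrC. Qed.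

End LinearFunctions.

(** * Vanishing of tensors tested on slices *)

Section Slices.
Variables (K : fieldType) (V W : lmodType K).

(* A formal sum is shortened by eliminating a left leg, which a non-zero slice
   expresses through the others. *)
Lemma tlift_slices0 (U : lmodType K) (I : Type) (f : I -> W -> K^o)
    (G : V -> W -> U) (z : V ⊗ W) :
  (forall i, linear (f i)) -> bilin G ->
  (forall i, tlift (fun v w => (f i w : K) *: v) z = 0) ->
  (forall v w, (forall i, f i w = 0) -> G v w = 0) -> tlift G z = 0.
Proof.
move=> lf bG; rewrite /tlift; move: (repr z) => s.
have [n] := ubnP (size s); elim: n s => // n IHn s szs s0 G0.
have [s1|] := pselect (forall p i, p \in s -> f i p.2 = 0).
  rewrite /formal_sum big_seq big1 // => p ps; apply: G0 => i; exact: s1.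
move/existsNP => [p /existsNP [i /not_implyP [ps /eqP fp0]]].
pose c : K := f i p.2.
pose s' := [seq (q.1, q.2 - ((f i q.2 : K) / c) *: p.2) | q <- rem p s].
(* Stated for every bilinear [F]: with [G] it transports the goal, with the slices it gives their
   vanishing for the shorter sum. *)
have eq_s' (X : lmodType K) (F : V -> W -> X) :
    bilin F -> formal_sum F s' = formal_sum F s.
  move=> bF.
  have Zl k v w : F (k *: v) w = k *: F v w := lin_scale (bF.1 w) k v.
  have Zr k v w : F v (k *: w) = k *: F v w := lin_scale (bF.2 v) k w.
  rewrite {2}/formal_sum (perm_big _ (perm_to_rem ps)) big_cons /=.
  have := s0 i; rewrite /formal_sum (perm_big _ (perm_to_rem ps)) big_cons /=.
  move=> /eqP; rewrite addr_eq0 -/c => /eqP p1E.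
  have -> : F p.1 p.2 = c^-1 *: F (c *: p.1) p.2.
    by rewrite Zl scalerA mulVf // scale1r.
  rewrite p1E -scaleN1r Zl scalerA mulrN1.
  rewrite (lin_sum (f := F^~ p.2)); last exact: bF.1.
  rewrite scaler_sumr -big_split /= /formal_sum big_map.
  apply: eq_bigr => q _ /=.
  by rewrite (lin_sub (bF.2 q.1)) Zr Zl scalerA addrC mulrC mulNr scaleNr.
rewrite -eq_s' //; apply: IHn => //.
- rewrite size_map size_rem // -ltnS prednK //.
  by case: (s) ps.
- move=> j; rewrite (eq_s' _ (fun v w => (f j w : K) *: v)) ?s0 //.
  by have lj := lf j; lin.
Qed.

End Slices.

(** * Antipodes of group-like elements, twisted antipodes of pure tensors *)

Section GroupLike.
Variables (K : fieldType) (A : hopfAlgType K).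
Implicit Types s t : A.

Lemma group_like_antipodel s : group_like s -> antipode s * s = 1.
Proof.
move=> [Ds es]; have := antipodel s; rewrite Ds es scale1r tlift_tens //; lin.
Qed.

Lemma group_like_antipode s t : group_like s -> s * t = 1 -> antipode s = t.
Proof.
by move=> gs st; rewrite -[LHS]mulr1 -st mulrA group_like_antipodel ?mul1r.
Qed.

End GroupLike.

(** The coproduct of [a ⊗ b] shuffles those of [a] and [b], and the twisting functional is a
    product, so the legs separate. *)
Lemma twisted_antipode_tensor (K : fieldType) (A B : hopfAlgType K)
    (d1 : A -> K^o) (d2 : B -> K^o) (a : A) (b : B) :
  linear d1 -> linear d2 ->
  twisted_antipode (tlift (fun x y => (d1 x : K) *: d2 y)) (a ⊗ b) =
  twisted_antipode d1 a ⊗ twisted_antipode d2 b.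
Proof.
move=> l1 l2; rewrite /twisted_antipode.
have -> : coproduct (a ⊗ b) = tmid (coproduct a) (coproduct b).
  exact: tens_coproduct_tens.
have bm := @tmid_bilin K A B A B.
have b12 : bilin (fun x y => (d1 x : K) *: d2 y) by lin.
move: (coproduct a) (coproduct b) => x y.
tensor_ind x => a1 a2; tensor_ind y => b1 b2.
rewrite tmid_tens !tlift_tens; try lin.
by rewrite [antipode _]tens_antipode_tens tensZl tensZr scalerA.
Qed.

(** * Actions of the dual and their transposes *)

Section DualActions.
Variables (K : fieldType) (H : bijHopfAlgType K) (Hd : hopf_dual H).
Local Notation ev := (@dual_eval K H Hd).
Implicit Types (u v w s : Hd) (x y g : H).

Let bev := @dual_eval_bilin K H Hd.

Lemma dual_ext v w : (forall x, ev v x = ev w x) -> v = w.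
Proof.
move=> e; apply/eqP; rewrite -subr_eq0; apply/eqP/dual_eval_inj => x.
by rewrite (lin_sub (bev.1 x)) e subrr.
Qed.

Lemma dual_sep x y : (forall w, ev w x = ev w y) -> x = y.
Proof.
move=> e; apply/eqP; rewrite -subr_eq0; apply/eqP/(dual_eval_sep (h := Hd)) => w.
by rewrite (lin_sub (bev.2 w)) e subrr.
Qed.

(** Actions are transposes of multiplications in the dual; through [dual_sep], identities between
    them become algebra in [Hd]. *)
Lemma ev_lact w v x : ev w (lact v x) = ev (v * w) x.
Proof.
have b := bev; rewrite dual_eval_mul /lact (tlift_comp (h := ev w)); try lin.
by apply: eq_tlift => a c; rewrite (lin_scale (bev.2 w)).
Qed.

Lemma ev_ract w v x : ev w (ract x v) = ev (w * v) x.
Proof.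
have b := bev; rewrite dual_eval_mul /ract (tlift_comp (h := ev w)); try lin.
by apply: eq_tlift => a c; rewrite (lin_scale (bev.2 w)) /GRing.scale /= mulrC.
Qed.

Lemma counit_lact w x : counit (lact w x) = ev w x :> K.
Proof. by rewrite -(dual_eval_one Hd) ev_lact mulr1. Qed.

Lemma lact1 x : lact (1 : Hd) x = x.
Proof. by apply: dual_sep => w; rewrite ev_lact mul1r. Qed.

Lemma ract1 x : ract x (1 : Hd) = x.
Proof. by apply: dual_sep => w; rewrite ev_ract mulr1. Qed.

Lemma ev_antipodeV w x : ev (antipodeV w) x = ev w (antipodeV x).
Proof.
by rewrite -[x in LHS]antipodeVK -dual_eval_antipode antipodeVK.
Qed.

Lemma lact_antipode v x : lact v (antipode x) = antipode (ract x (antipode v)).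
Proof.
apply: dual_sep => w.
by rewrite ev_lact -!dual_eval_antipode antipodeM ev_ract.
Qed.

Lemma ract_antipodeV v x :
  ract (antipodeV x) v = antipodeV (lact (antipodeV v) x).
Proof.
apply: dual_sep => w.
by rewrite ev_ract -!ev_antipodeV antipodeVM ev_lact.
Qed.

(** The functional x -> w (g x). The coproduct keeps it inside [Hd], which need not contain every
    functional. *)
Definition lshift g w : Hd := tlift (fun a b => (ev a g : K) *: b) (coproduct w).
Definition rshift w g : Hd := tlift (fun a b => (ev b g : K) *: a) (coproduct w).

Lemma ev_lshift g w x : ev (lshift g w) x = ev w (g * x).
Proof.
have b := bev; rewrite -dual_eval_coproduct /lshift.
rewrite (tlift_comp (h := ev^~ x)); try lin.
by apply: eq_tlift => a c; rewrite (lin_scale (bev.1 x)).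
Qed.

Lemma ev_rshift g w x : ev (rshift w g) x = ev w (x * g).
Proof.
have b := bev; rewrite -dual_eval_coproduct /rshift.
rewrite (tlift_comp (h := ev^~ x)); try lin.
by apply: eq_tlift => a c; rewrite (lin_scale (bev.1 x)) /GRing.scale /= mulrC.
Qed.

Section GroupLikeFunctional.
Variable s : Hd.
Hypothesis gs : group_like s.

Lemma ev_group_likeM x y : ev s (x * y) = (ev s x : K) * ev s y.
Proof.
by have b := bev; rewrite -dual_eval_coproduct gs.1 tlift_tens //; lin.
Qed.

Lemma ev_group_like1 : ev s 1 = 1.
Proof. by rewrite -dual_eval_counit gs.2. Qed.

Lemma lact_group_likeM x y : lact s (x * y) = lact s x * lact s y.
Proof.
by have b := @lact_bilin K H Hd; rewrite lact_mul gs.1 tlift_tens //; lin.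
Qed.

Lemma ract_group_likeM x y : ract (x * y) s = ract x s * ract y s.
Proof.
by have b := @ract_bilin K H Hd; rewrite ract_mul gs.1 tlift_tens //; lin.
Qed.

End GroupLikeFunctional.

Section GroupLikeElement.
Variable g : H.
Hypothesis gg : group_like g.

Lemma evM_group_like v w : ev (v * w) g = (ev v g : K) * ev w g.
Proof.
by have b := bev; rewrite dual_eval_mul gg.1 tlift_tens //; lin.
Qed.

Lemma lact_group_like w : lact w g = (ev w g : K) *: g.
Proof.
by have b := bev; rewrite /lact gg.1 tlift_tens //; lin.
Qed.

Lemma ract_group_like w : ract g w = (ev w g : K) *: g.
Proof.
by have b := bev; rewrite /ract gg.1 tlift_tens //; lin.
Qed.

(** A group-like [g] is an eigenvector of every action, so it leaves the product and its eigenvalue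
    becomes a translation of [w]. *)
Lemma lact_mul_group_like w x : lact w (g * x) = g * lact (lshift g w) x.
Proof.
have b := bev; have bl := @lact_bilin K H Hd; rewrite lact_mul /lshift.
rewrite (tlift_comp (h := fun v => g * lact v x)); try lin.
apply: eq_tlift => a c; rewrite lact_group_like.
by rewrite (lin_scale (bl.1 x)) -scalerAl -scalerAr.
Qed.

Lemma lact_group_like_mul w x : lact w (x * g) = lact (rshift w g) x * g.
Proof.
have b := bev; have bl := @lact_bilin K H Hd; rewrite lact_mul /rshift.
rewrite (tlift_comp (h := fun v => lact v x * g)); try lin.
apply: eq_tlift => a c; rewrite lact_group_like.
by rewrite (lin_scale (bl.1 x)) -scalerAl -scalerAr.
Qed.

Lemma ract_mul_group_like w x : ract (g * x) w = g * ract x (lshift g w).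
Proof.
have b := bev; have br := @ract_bilin K H Hd; rewrite ract_mul /lshift.
rewrite (tlift_comp (h := fun v => g * ract x v)); try lin.
apply: eq_tlift => a c; rewrite ract_group_like.
by rewrite (lin_scale (br.2 x)) -scalerAl -scalerAr.
Qed.

Lemma ract_group_like_mul w x : ract (x * g) w = ract x (rshift w g) * g.
Proof.
have b := bev; have br := @ract_bilin K H Hd; rewrite ract_mul /rshift.
rewrite (tlift_comp (h := fun v => ract x v * g)); try lin.
apply: eq_tlift => a c; rewrite ract_group_like.
by rewrite (lin_scale (br.2 x)) -scalerAl -scalerAr.
Qed.

End GroupLikeElement.
End DualActions.

(** * Invariance against the dual actions, and faithfulness *)

Section InvariantWeights.
Variables (R : realType) (H : bijHopfAlgType R[i]) (Hd : hopf_dual H).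
Local Notation C := R[i].
Local Notation ev := (@dual_eval C H Hd).
Variable p : H -> C^o.
Hypothesis lp : linear p.

Let bev := @dual_eval_bilin C H Hd.

(** This is the invariance identity with [w] paired to the leg that the slice leaves free. *)
Lemma left_invariant_lact (w : Hd) (x y : H) : left_invariant p ->
  p (x * lact w y) = p (lact (antipode w) x * y).
Proof.
move=> inv; have b := bev; have l1 : linear (slicer p) by rewrite /slicer; lin.
have -> : p (x * lact w y) = ev w (slicer p ((1 ⊗ x) * coproduct y)).
  rewrite /lact; move: (coproduct y) => t; tensor_ind t => c d.
  rewrite tensM mul1r /slicer !tlift_tens; try lin.
  by rewrite -scalerAr (lin_scale lp) (lin_scale (bev.2 w)) /GRing.scale /= mulrC.
have -> : p (lact (antipode w) x * y) =
          ev (antipode w) (slicer p (coproduct x * (1 ⊗ y))).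
  rewrite /lact; move: (coproduct x) => t; tensor_ind t => c d.
  rewrite tensM mulr1 /slicer !tlift_tens; try lin.
  by rewrite -scalerAl (lin_scale lp) (lin_scale (bev.2 _)) /GRing.scale /= mulrC.
by rewrite inv dual_eval_antipode.
Qed.

Lemma right_invariant_ract (w : Hd) (x y : H) : right_invariant p ->
  p (ract x w * y) = p (x * ract y (antipode w)).
Proof.
move=> inv; have b := bev; have l1 : linear (slicel p) by rewrite /slicel; lin.
have -> : p (x * ract y (antipode w)) =
          ev (antipode w) (slicel p ((x ⊗ 1) * coproduct y)).
  rewrite /ract; move: (coproduct y) => t; tensor_ind t => c d.
  rewrite tensM mul1r /slicel !tlift_tens; try lin.
  by rewrite -scalerAr (lin_scale lp) (lin_scale (bev.2 _)) /GRing.scale /= mulrC.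
have -> : p (ract x w * y) = ev w (slicel p (coproduct x * (y ⊗ 1))).
  rewrite /ract; move: (coproduct x) => t; tensor_ind t => c d.
  rewrite tensM mulr1 /slicel !tlift_tens; try lin.
  by rewrite -scalerAl (lin_scale lp) (lin_scale (bev.2 _)) /GRing.scale /= mulrC.
by rewrite inv dual_eval_antipode.
Qed.

(* Let N be the set of a with [p (a * x) = 0] for all x. It is stable under all
   [lact w], so [coproduct a] lies in [H ⊗ N] for a in N; then
   [counit a * p b = p (a_(2) S^-1(a_(1)) b)] vanishes. *)
Lemma left_invariant_faithful (a : H) :
  left_invariant p -> (exists x, p x <> 0) -> (forall x, p (a * x) = 0) -> a = 0.
Proof.
move=> inv [b0 pb0] a0; have b := bev; have bl := @lact_bilin C H Hd.
have N_lact (w : Hd) x : p (lact w a * x) = 0.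
  by rewrite -[w]antipodeVK -left_invariant_lact.
(* N contains every [lact w a], whose counit is the pairing of [w] with [a]; hence it suffices that
   the counit vanishes on N. *)
suff counit0 c : (forall x, p (c * x) = 0) -> counit c = 0 :> C.
  apply: (dual_sep (Hd := Hd)) => w.
  by rewrite -counit_lact counit0 // (linear_morph0 (bev.2 w)).
move=> {a a0 N_lact} c0.
suff : (counit c : C) *: p b0 = 0.
  by move/eqP; rewrite scaler_eq0 => /orP[/eqP //|/eqP].
rewrite -(lin_scale lp) -[b0 in LHS]mul1r scalerAl -antipodeV_flipl.
rewrite (tlift_comp (h := fun u => p (u * b0))); try lin.
apply: (@tlift_slices0 _ _ _ _ H (fun x u => p (u * x))); try lin.
- by move=> x; lin.
- move=> x; apply: (dual_sep (Hd := Hd)) => w.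
  rewrite (linear_morph0 (bev.2 w)).
  have : p (lact w c * x) = 0 by rewrite -[w]antipodeVK -left_invariant_lact.
  rewrite /lact; move=> <-; move: (coproduct c) => t; tensor_ind t => d e.
  rewrite !tlift_tens; try lin.
  by rewrite -scalerAl (lin_scale lp) (lin_scale (bev.2 _)) /GRing.scale /= mulrC.
- by move=> d e e0; rewrite -mulrA e0.
Qed.

End InvariantWeights.

(** * Complex powers of a group-like element *)

Section ComplexPowers.
Variables (R : realType) (A : hopfAlgType R[i]) (d : A) (dpow : R[i] -> A).
Hypothesis dP : complex_powers d dpow.

Lemma cpow_group_like z : group_like (dpow z).
Proof. by have [gd _ _] := dP; apply: gd. Qed.

Lemma cpowD z w : dpow z * dpow w = dpow (z + w).
Proof. by have [_ -> _] := dP. Qed.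

(** [dpow 0] is idempotent by additivity of exponents, and left invertible because it is
    group-like. *)
Lemma cpow0 : dpow 0 = 1.
Proof.
have g0 := cpow_group_like 0.
by rewrite -[LHS]mul1r -(group_like_antipodel g0) -mulrA cpowD addr0.
Qed.

Lemma cpowNK z : dpow (- z) * dpow z = 1.
Proof. by rewrite cpowD addNr cpow0. Qed.

Lemma cpowKN z : dpow z * dpow (- z) = 1.
Proof. by rewrite cpowD addrN cpow0. Qed.

Lemma antipode_cpow z : antipode (dpow z) = dpow (- z).
Proof. by apply: group_like_antipode (cpowKN z); apply: cpow_group_like. Qed.

End ComplexPowers.

Lemma antipodeV_cpow (R : realType) (A : bijHopfAlgType R[i]) (d : A)
    (dpow : R[i] -> A) z :
  complex_powers d dpow -> antipodeV (dpow z) = dpow (- z).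
Proof.
by move=> dP; rewrite -[z in LHS]opprK -(antipode_cpow dP (- z)) antipodeK.
Qed.

(** * The modular automorphism at i and the square of the antipode *)

Section QuantumGroup.
Variables (R : realType) (H : bijHopfAlgType R[i]) (Hd : hopf_dual H).
Local Notation C := R[i].
Local Notation ev := (@dual_eval C H Hd).
Variables (phi : H -> C^o) (delta : H) (dpow : C -> H) (sigma : Hd)
  (spow : C -> Hd) (mphi mpsi : C -> H -> H).
Hypothesis qg : lc_quantum_group phi delta dpow sigma spow mphi mpsi.

Let bev := @dual_eval_bilin C H Hd.
Let h : C := 2^-1.
Let lphi : linear phi := haar_linear (qg_left_haar qg).
Let phi_inv : left_invariant phi := haar_invariant (qg_left_haar qg).
Let dP : complex_powers delta dpow := qg_delta_powers qg.
Let sP : complex_powers sigma spow := qg_sigma_powers qg.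
Let gd := cpow_group_like dP.
Let gs := cpow_group_like sP.
Local Notation P w z := (ev (spow w) (dpow z) : C).

Lemma haar_faithful x y : (forall z, phi (x * z) = phi (y * z)) -> x = y.
Proof.
move=> e; apply/eqP; rewrite -subr_eq0; apply/eqP.
apply: (left_invariant_faithful Hd lphi) => //.
  exact: haar_neq0 (qg_left_haar qg).
by move=> z; rewrite mulrBl (lin_sub lphi) e subrr.
Qed.

Lemma pairing_powDr w z z' : P w (z + z') = P w z * P w z'.
Proof. by rewrite -(cpowD dP) ev_group_likeM. Qed.

Lemma pairing_powN w z : P w (- z) * P w z = 1.
Proof. by rewrite -pairing_powDr addNr (cpow0 dP) ev_group_like1. Qed.

Lemma lact_pow w z : lact (spow w) (dpow z) = P w z *: dpow z.
Proof. exact: lact_group_like. Qed.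

Lemma ract_pow w z : ract (dpow z) (spow w) = P w z *: dpow z.
Proof. exact: ract_group_like. Qed.

Lemma modular_iE x :
  mphi 'i%C x = dpow (- h) * ract (lact (spow (- h)) x) (spow (- h)) * dpow h.
Proof.
rewrite (qg_modular_phiE qg) /modular_formula.
have -> : 'i%C * 'i%C / 2 = - h :> C by rewrite -expr2 sqr_i mulN1r.
by rewrite opprK.
Qed.

Lemma modular_NiE x :
  mphi (- 'i%C) x = dpow h * ract (lact (spow h) x) (spow h) * dpow (- h).
Proof.
rewrite (qg_modular_phiE qg) /modular_formula.
by have -> : 'i%C * - 'i%C / 2 = h :> C by rewrite mulrN -expr2 sqr_i opprK mul1r.
Qed.

Lemma modular_iNi x : mphi 'i%C (mphi (- 'i%C) x) = x.
Proof.
have mP := qg_modular_phi qg.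
by rewrite -(modularD mP) addrN (modular0 mP).
Qed.

Lemma KMS_Ni x y : phi (x * y) = phi (y * mphi (- 'i%C) x).
Proof.
rewrite -{1}[x]modular_iNi; exact: esym (modular_KMS (qg_modular_phi qg) _ _).
Qed.

(* Moving w across phi by invariance, then y by KMS, and back. *)
Lemma modular_i_lact (w : Hd) y :
  mphi 'i%C (lact w y) = lact (antipode (antipode w)) (mphi 'i%C y).
Proof.
have KMS := modular_KMS (qg_modular_phi qg).
apply: haar_faithful => x.
by rewrite -KMS left_invariant_lact // KMS left_invariant_lact.
Qed.

(** The counit sends the powers of delta to 1 and merges the two actions of [spow (- h)] into one
    pairing. *)
Lemma counit_modular_i y : counit (mphi 'i%C y) = ev (spow (- 1)) y :> C.
Proof.
rewrite modular_iE !rmorphM /= (gd _).2 (gd _).2 mul1r mulr1.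
rewrite -(dual_eval_one Hd) ev_ract mul1r ev_lact (cpowD sP).
by rewrite -opprD -mulr2n -mulr_natl mulfV // pnatr_eq0.
Qed.

(** Paired with [w], the left side is the counit of the action of [antipode (antipode w)] on the
    modular image of [y], that is, of the modular image of [lact w y]. *)
Lemma antipode2_modular_i y :
  antipode (antipode (mphi 'i%C y)) = ract y (spow (- 1)).
Proof.
apply: (dual_sep (Hd := Hd)) => w.
rewrite -!dual_eval_antipode -counit_lact -modular_i_lact counit_modular_i.
by rewrite ev_lact ev_ract.
Qed.

(** The preceding identity at [y = mphi (- 'i%C) x]. The scalars that [spow (- 1)] picks up on
    [dpow h] and [dpow (- h)] cancel. *)
Lemma antipode2E x : antipode (antipode x) =
  dpow h * ract (lact (spow h) x) (spow (- h)) * dpow (- h).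
Proof.
rewrite -[x in LHS]modular_iNi antipode2_modular_i modular_NiE.
rewrite !ract_group_likeM // !ract_pow -ractM (cpowD sP).
rewrite -!scalerAl -scalerAr scalerA mulrC pairing_powN scale1r.
congr (_ * ract _ (spow _) * _).
by rewrite {1}[1]splitr mul1r opprD addrNK.
Qed.

(** * Trace property and invariance of the midweight *)

Local Notation q := (4^-1 : C).
Local Notation tau := (midweight phi dpow).

Lemma half_quarter : q + q = h.
Proof. by rewrite /h [RHS]splitr -invfM -natrM. Qed.

Lemma modular_Ni_pow z : mphi (- 'i%C) (dpow z) = (P h z) ^+ 2 *: dpow z.
Proof.
have br := @ract_bilin C H Hd.
rewrite modular_NiE lact_pow (lin_scale (br.1 _)) ract_pow scalerA -expr2.
by rewrite -scalerAr -scalerAl !(cpowD dP) addrC addrA addNr add0r.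
Qed.

(** KMS cycles [dpow (- q) * a] on one side and [dpow (- q)] alone on the other, giving the same
    eigenvalue. The remaining two factors [dpow (- q)] absorb the [dpow h] of the modular
    automorphism. *)
Lemma midweight_trace a b :
  tau (a * b) = tau (b * ract (lact (spow h) a) (spow h)).
Proof.
have [_ mM] := modular_multiplicative (qg_modular_phi qg) (- 'i%C).
rewrite /midweight !mulrA -[_ * b * _]mulrA KMS_Ni mM modular_Ni_pow modular_NiE.
rewrite -[in RHS](mulrA (dpow _)) -[in RHS](mulrA (dpow _)) [in RHS]KMS_Ni.
rewrite modular_Ni_pow -!scalerAl -!scalerAr; congr (phi (_ *: _)).
set x := ract _ _; rewrite -!mulrA (cpowD dP) -opprD half_quarter.
congr (_ * _); rewrite !mulrA !(cpowD dP).
by rewrite -opprD half_quarter addNr (cpow0 dP) mul1r.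
Qed.

(** Crossing each of the two outer factors [dpow (- q)] translates the functional by [dpow q];
    together they give the [dpow h] of the first leg of [delta_tilde]. *)
Lemma midweight_lact (w : Hd) a b :
  tau (lact w a * b) = tau (a * lact (antipodeV (lshift (dpow h) w)) b).
Proof.
rewrite /midweight !mulrA.
have -> : dpow (- q) * lact w a = lact (lshift (dpow q) w) (dpow (- q) * a).
  rewrite lact_mul_group_like //; congr (_ * lact _ _); apply: dual_ext => x.
  by rewrite !ev_lshift mulrA (cpowKN dP) mul1r.
set v := lshift (dpow q) w; rewrite -mulrA -[v]antipodeVK.
rewrite -left_invariant_lact // lact_group_like_mul // mulrA.
congr (phi (_ * lact _ _ * _)); apply: dual_ext => x.
rewrite ev_rshift !ev_antipodeV !ev_lshift antipodeVM (antipodeV_cpow _ dP).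
by rewrite opprK mulrA (cpowD dP) half_quarter.
Qed.

(** The midweight lies halfway between the two Haar weights; this form gives access to right
    invariance. *)
Lemma midweight_psiE x : tau x = right_haar phi (dpow q * x * dpow q).
Proof.
rewrite /midweight (qg_phi_psi qg) -/h -half_quarter -(cpowD dP).
rewrite !mulrA -[_ * dpow q * dpow (- q)]mulrA (cpowKN dP) mulr1.
by rewrite -!mulrA [dpow (- q) * _]mulrA (cpowNK dP) mul1r.
Qed.

(** As for the left action, but from the right Haar weight: the outer factors are now [dpow q],
    hence the opposite sign in [dpow (- h)]. *)
Lemma midweight_ract (w : Hd) a b :
  tau (ract a w * b) = tau (a * ract b (antipode (lshift (dpow (- h)) w))).
Proof.
have lpsi : linear (right_haar phi).
  by rewrite /right_haar => k x y; rewrite linearP lphi.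
rewrite !midweight_psiE !mulrA.
have -> : dpow q * ract a w = ract (dpow q * a) (lshift (dpow (- q)) w).
  rewrite ract_mul_group_like //; congr (_ * ract _ _); apply: dual_ext => x.
  by rewrite !ev_lshift mulrA (cpowNK dP) mul1r.
rewrite -mulrA right_invariant_ract //; last exact: qg_right_haar qg.
rewrite ract_group_like_mul // mulrA.
congr (right_haar phi (_ * ract _ _ * _)); apply: dual_ext => x.
rewrite ev_rshift !dual_eval_antipode !ev_lshift antipodeM (antipode_cpow dP).
by rewrite mulrA (cpowD dP) -opprD half_quarter.
Qed.

(* The two legs of [sigma_tilde^-1 twisted_antipode]; the factor of T1 is on the
   right because the first leg lives in the opposite algebra. *)
Let T1 (u : Hd) : Hd := antipodeV (lshift (dpow h) u) * spow (- h).
Let T2 (u : Hd) : Hd := spow (- h) * antipode (lshift (dpow (- h)) u).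

(** [T1] is the transpose of y -> delta^(1/2) S^-1(y.sigma^(-1/2)). Squaring it, the scalar comes
    from sigma^(-1/2) acting on delta^(1/2). *)
Let T1_twice u : T1 (T1 u) = P (- h) h *: u.
Proof.
apply: dual_ext => x.
have evT1 v y : ev (T1 v) y = ev v (dpow h * antipodeV (ract y (spow (- h)))).
  by rewrite /T1 -ev_ract ev_antipodeV ev_lshift.
rewrite !evT1 ract_group_likeM // ract_pow ract_antipodeV.
rewrite (antipodeV_cpow _ sP) opprK -scalerAl linearZ /= -scalerAr.
rewrite (lin_scale (bev.2 u)) (lin_scale (bev.1 x)); congr (_ *: ev u _).
rewrite antipodeVM (antipodeV_cpow _ dP).
(* [antipode2E] is solved for the inner actions, so that the two inverse antipodes cancel against
   the square. *)
have -> : lact (spow h) (ract x (spow (- h))) =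
          antipode (antipode (dpow (- h) * x * dpow h)).
  rewrite !antipodeM !(antipode_cpow dP) !opprK antipode2E lact_ract.
  by rewrite !mulrA (cpowNK dP) mul1r -mulrA (cpowNK dP) mulr1.
by rewrite !antipodeK !mulrA (cpowKN dP) mul1r -mulrA (cpowKN dP) mulr1.
Qed.

Let T2_twice u : T2 (T2 u) = P (- h) (- h) *: u.
Proof.
apply: dual_ext => x.
have evT2 v y : ev (T2 v) y = ev v (dpow (- h) * antipode (lact (spow (- h)) y)).
  by rewrite /T2 -ev_lact dual_eval_antipode ev_lshift.
rewrite !evT2 lact_group_likeM // lact_pow lact_antipode.
rewrite (antipode_cpow sP) opprK -scalerAl linearZ /= -scalerAr.
rewrite (lin_scale (bev.2 u)) (lin_scale (bev.1 x)); congr (_ *: ev u _).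
rewrite antipodeM (antipode_cpow dP) opprK antipode2E.
rewrite -lact_ract -lactM -!ractM (cpowNK sP) lact1 ract1.
by rewrite !mulrA (cpowNK dP) mul1r -mulrA (cpowNK dP) mulr1.
Qed.

(** * The modular pair on the tensor product and its involution *)

Lemma delta_tilde_bilin : @bilin C C^o Hd^c Hd
  (fun w1 w2 => (ev (w1 : Hd) (dpow h) : C) *: ev w2 (dpow (- h))).
Proof.
split=> [w2 k u v | w1 k u v].
  have -> : ev (k *: u + v : Hd^c) (dpow h) = k *: ev u (dpow h) + ev v (dpow h).
    exact: bev.1.
  by rewrite scalerDl scalerA.
by rewrite bev.1 scalerDr !scalerA mulrC.
Qed.

Lemma delta_tilde_tens (w1 w2 : Hd) :
  delta_tilde dpow ((w1 : Hd^c) ⊗ w2) = (ev w1 (dpow h) : C) * ev w2 (dpow (- h)).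
Proof. by rewrite /delta_tilde tlift_tens //; exact: delta_tilde_bilin. Qed.

Lemma delta_tilde_linear : linear (delta_tilde (Hd := Hd) dpow).
Proof. by apply: tlift_linear; exact: delta_tilde_bilin. Qed.

(** Twisting by evaluation at a group-like element is translation by it before the antipode. *)
Lemma twisted_antipode_tens (w1 w2 : Hd) :
  twisted_antipode (delta_tilde dpow) ((w1 : Hd^c) ⊗ w2 : Htilde Hd) =
  (antipodeV (lshift (dpow h) w1) : Hd^c) ⊗ antipode (lshift (dpow (- h)) w2).
Proof.
have b := bev.
pose d1 : Hd^c -> C^o := ev^~ (dpow h); pose d2 : Hd -> C^o := ev^~ (dpow (- h)).
have ld1 : linear d1 by exact: bev.1.
have ld2 : linear d2 by exact: bev.1.
apply: etrans (@twisted_antipode_tensor C Hd^c Hd d1 d2 w1 w2 ld1 ld2) _; congr tens.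
  (* The coproduct of the opposite algebra is that of [Hd], and its antipode is [antipodeV]. *)
  apply: (etrans (y := tlift (fun a c : Hd => (ev a (dpow h) : C) *: antipodeV c)
    (coproduct w1))) => //.
  rewrite /lshift (tlift_comp (h := antipodeV)); try lin.
  by apply: eq_tlift => a c; rewrite linearZ.
rewrite /lshift (tlift_comp (h := antipode)) /twisted_antipode; try lin.
by apply: eq_tlift => a c; rewrite linearZ.
Qed.

Lemma Htilde_mul (w1 w2 v1 v2 : Hd) :
  (((w1 : Hd^c) ⊗ w2) : Htilde Hd) * ((v1 : Hd^c) ⊗ v2) =
  ((v1 * w1 : Hd) : Hd^c) ⊗ (w2 * v2).
Proof. exact: tensM. Qed.

Lemma involution_tilde :
  in_involution (delta_tilde (Hd := Hd) dpow) (sigma_tilde spow).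
Proof.
exists ((spow (- h) : Hd^c) ⊗ spow (- h)).
split.
- by rewrite /sigma_tilde -/h Htilde_mul (cpowKN sP) (cpowNK sP).
- by rewrite /sigma_tilde -/h Htilde_mul (cpowKN sP) (cpowNK sP).
have ld := delta_tilde_linear.
have lS : linear (twisted_antipode (delta_tilde (Hd := Hd) dpow)).
  by rewrite /twisted_antipode; lin.
move=> u; tensor_ind u => w1 w2.
rewrite !(twisted_antipode_tens, Htilde_mul).
rewrite -[X in tens X _]/(T1 (T1 w1)) -[X in tens _ X]/(T2 (T2 w2)).
rewrite T1_twice T2_twice tensZr.
apply: etrans (_ : _ *: (_ *: _) = _); first by congr (_ *: _); exact: tensZl.
by rewrite scalerA pairing_powN scale1r.
Qed.

Lemma modular_pair_tilde :
  modular_pair (delta_tilde (Hd := Hd) dpow) (sigma_tilde spow).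
Proof.
have ld := delta_tilde_linear.
split.
- split=> //; split.
    have -> : (1 : Htilde Hd) = (1 : Hd^c) ⊗ (1 : Hd) by [].
    rewrite (delta_tilde_tens 1 1).
    by rewrite !dual_eval_one !(gd _).2 mulr1.
  move=> u v; tensor_ind u => w1 w2; tensor_ind v => v1 v2.
  rewrite Htilde_mul !delta_tilde_tens.
  (* Evaluation at a group-like element is multiplicative, and scalars commute, so the opposite
     product in the first leg does no harm. *)
  by rewrite !evM_group_like // (mulrC (ev v1 _ : C)) mulrACA.
- split.
    apply: etrans (tens_coproduct_tens _ _) _.
    by rewrite (gs h).1 -tmid_tens; congr tmid; exact: (gs h).1.
  apply: etrans (tens_counit_tens _ _) _.
  by rewrite (gs h).2 mul1r; exact: (gs h).2.
- by rewrite /sigma_tilde delta_tilde_tens mulrC pairing_powN.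
Qed.

End QuantumGroup.

Theorem theorem14 (R : realType) (H : bijHopfAlgType R[i]) (Hd : hopf_dual H)
    (phi : H -> R[i]^o) (delta : H) (dpow : R[i] -> H)
    (sigma : Hd) (spow : R[i] -> Hd) (mphi mpsi : R[i] -> H -> H) :
  lc_quantum_group phi delta dpow sigma spow mphi mpsi ->
  (modular_pair (delta_tilde dpow) (sigma_tilde spow) /\
   in_involution (delta_tilde dpow) (sigma_tilde spow)) /\
  (sigma_trace (canonical_action Hd) (sigma_tilde spow) (midweight phi dpow) /\
   delta_invariant (canonical_action Hd) (delta_tilde dpow)
     (midweight phi dpow)).
Proof.
move=> qg; have lphi := haar_linear (qg_left_haar qg).
have ltau : linear (midweight phi dpow) by rewrite /midweight; lin.
have bc := @canonical_act_bilin _ H Hd.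
have ld := @delta_tilde_linear R H Hd dpow.
have lS : linear (twisted_antipode (delta_tilde (Hd := Hd) dpow)).
  by rewrite /twisted_antipode; lin.
split; first by split; [exact: modular_pair_tilde qg | exact: involution_tilde qg].
split.
  split=> // a b; rewrite (midweight_trace qg) -canonical_act_tens //.
move=> u a b /=; tensor_ind u => w1 w2.
(* From the right-hand side, the second leg returns to [a] first, then the first leg; the left and
   right actions commute. *)
rewrite twisted_antipode_tens !canonical_act_tens -(midweight_ract qg).
by rewrite -(midweight_lact qg) lact_ract.
Qed.
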